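(* Let $\pi(M)$ be a matrix superharmonic prior on $\mathbb{R}^{n\times p}$ with $m_\pi(X)<\infty$ for every $X\in\mathbb{R}^{n\times p}$. Then the generalized Bayes estimator $\hat M^\pi(X)=X+\widetilde\nabla\log m_\pi(X)$ with respect to $\pi(M)$ is minimax under the matrix quadratic loss.
   Context: Let $n,p\ge 1$ be integers with $n-p-1>0$. $X\sim \mathrm{N}_{n,p}(M,I_n,I_p)$ means that $X\in\mathbb{R}^{n\times p}$ has independent entries $X_{ai}\sim \mathrm{N}(M_{ai},1)$, with $M\in\mathbb{R}^{n\times p}$ unknown; its density is $p(X\mid M)$ and $\mathrm{E}_M$ is expectation under it. An estimator is a measurable function $\hat M=\hat M(X)\in\mathbb{R}^{n\times p}$. The matrix quadratic loss is $L(M,\hat M)=(\hat M-M)^\top(\hat M-M)$ and the risk is $R(M,\hat M)=\mathrm{E}_M[L(M,\hat M(X))]$, so $c^\top R(M,\hat M)c=\mathrm{E}_M[\|\hat Mc-Mc\|^2]\in[0,\infty]$. An estimator $\hat M$ is minimax under the matrix quadratic loss if, for every $c\in\mathbb{R}^p$, $\sup_M c^\top R(M,\hat M)c=\inf_{\hat M'}\sup_M c^\top R(M,\hat M')c$, the infimum being over all estimators. A prior is a (possibly improper) nonnegative measurable function $\pi:\mathbb{R}^{n\times p}\to[0,\infty]$ that is not almost everywhere zero. Its marginal is $m_\pi(X)=\int p(X\mid M)\pi(M)\,dM$. The matrix gradient is $(\widetilde\nabla f(X))_{ai}=\frac{\partial}{\partial X_{ai}}f(X)$. When $m_\pi<\infty$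 everywhere, the generalized Bayes estimator is the posterior mean $\int M p(X\mid M)\pi(M)\,dM/m_\pi(X)=X+\widetilde\nabla\log m_\pi(X)$. Let $S_{0,1}=\{e\in\mathbb{R}^n:\|e\|=1\}$ with surface element $ds$ and surface area $\Omega_n$. For $f:\mathbb{R}^{n\times p}\to\mathbb{R}\cup\{\infty\}$, $X\in\mathbb{R}^{n\times p}$, $\rho\in\mathbb{R}^p$, put $L(f:X,\rho)=\frac{1}{\Omega_n}\int_{S_{0,1}}f(X+e\rho^\top)\,ds(e)$. The function $f$ is matrix superharmonic if it is lower semicontinuous, $f\not\equiv\infty$, and $L(f:X,\rho)\le f(X)$ for every $X\in\mathbb{R}^{n\times p}$ and $\rho\in\mathbb{R}^p$. *)

(* Defs.v *)
From HB Require Import structures.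
From mathcomp Require Import all_boot all_order all_algebra.
From mathcomp Require Import all_classical all_reals all_analysis.
From mathcomp Require Import measurable_realfun.
Set Implicit Arguments.
Unset Strict Implicit.
Unset Printing Implicit Defensive.
Import Order.TTheory GRing.Theory Num.Theory.
Import numFieldNormedType.Exports.

Local Open Scope classical_set_scope.
Local Open Scope ring_scope.
Local Open Scope ereal_scope.

Definition measure_mx_display : measure_display -> measure_display.
Proof. exact. Qed.

(* The product sigma-algebra, generated by the entries; for real matrices it is
   the Borel sigma-algebra of R^(m x n). *)
Section measurable_matrix.
Context {d} {T : measurableType d}.
Variables m n : nat.

Definition mx_sigma : set (set 'M[T]_(m, n)) :=
  <<s \bigcup_(ij in [set: 'I_m * 'I_n])
        preimage_set_system setT (fun A : 'M[T]_(m, n) => A ij.1 ij.2)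
          measurable >>.

Let mx_sigma0 : mx_sigma set0.
Proof. exact: sigma_algebra0. Qed.

Let mx_sigmaC A : mx_sigma A -> mx_sigma (~` A).
Proof. exact: sigma_algebraC. Qed.

Let mx_sigma_bigcup (F : (set 'M[T]_(m, n))^nat) :
  (forall i, mx_sigma (F i)) -> mx_sigma (\bigcup_i (F i)).
Proof. exact: sigma_algebra_bigcup. Qed.

HB.instance Definition _ := @isMeasurable.Build (measure_mx_display d)
  'M[T]_(m, n) mx_sigma mx_sigma0 mx_sigmaC mx_sigma_bigcup.

Lemma measurable_mx_entry i j :
  measurable_fun [set: 'M[T]_(m, n)] (fun A : 'M[T]_(m, n) => A i j).
Proof.
move=> _ Y mY; rewrite setTI; apply: sub_sigma_algebra.
by exists (i, j) => //; exists Y => //; rewrite setTI.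
Qed.

Lemma measurable_fun_mxP d' (T' : measurableType d') (f : T' -> 'M[T]_(m, n)) :
  measurable_fun [set: T'] f <->
  forall i j, measurable_fun [set: T'] (fun x => f x i j).
Proof.
split=> [mf i j|mf].
  exact: (measurableT_comp (measurable_mx_entry i j) mf).
apply: (@measurability _ _ _ _ setT f
  (\bigcup_(ij in [set: 'I_m * 'I_n])
    preimage_set_system setT (fun A : 'M[T]_(m, n) => A ij.1 ij.2)
      measurable)) => //.
move=> _ [_ [[i j] _ [B mB <-]] <-]; rewrite setTI.
exact: mf.
Qed.

End measurable_matrix.

Section lebesgue_matrix.
Context {R : realType}.

Section push.
Context d1 d2 (T1 : measurableType d1) (T2 : measurableType d2).
Variables (mu : {measure set T1 -> \bar R}) (f : T1 -> T2) (g : T2 -> T1).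
Hypotheses (smu : sigma_finite setT mu) (mf : measurable_fun setT f) (mg : measurable_fun setT g)
  (fK : cancel f g).

(* Pushforward along an injection with a measurable left inverse, which keeps
   sigma-finiteness. *)
Definition pushforward_can of sigma_finite setT mu & measurable_fun setT f &
  measurable_fun setT g & cancel f g := pushforward mu f.

Let nu := pushforward_can smu mf mg fK.

Let pm : {measure set T2 -> \bar R}.
Proof.
unshelve refine (pushforward mu f : {measure set T2 -> \bar R}).
exact: mf.
Defined.

HB.instance Definition _ := Measure.copy nu pm.

Let nu_sigma_finite : sigma_finite setT nu.
Proof.
have [F FT Foo] := smu.
exists (fun i => g @^-1` F i).
  by rewrite -preimage_bigcup -FT preimage_setT.
move=> i; have [mFi Fi] := Foo i; split.
  by rewrite -[X in measurable X]setTI; exact: mg.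
rewrite /nu /pushforward_can /pushforward -comp_preimage.
by rewrite (_ : g \o f = id) ?preimage_id//; apply/funext => x /=.
Qed.

HB.instance Definition _ := Measure_isSigmaFinite.Build _ _ _ nu
  nu_sigma_finite.

End push.

(* The library proves this too, but its sigma-finite instance for products is
   shadowed by the one for finite measures. *)
Lemma product_sigma_finite d1 d2 (T1 : measurableType d1)
    (T2 : measurableType d2) (m1 : {sigma_finite_measure set T1 -> \bar R})
    (m2 : {sigma_finite_measure set T2 -> \bar R}) :
  sigma_finite setT (m1 \x m2).
Proof.
have /sigma_finiteP[F [TF ndF Foo]] := sigma_finiteT m1.
have /sigma_finiteP[G [TG ndG Goo]] := sigma_finiteT m2.
exists (fun n => F n `*` G n).
  rewrite -setXTT TF TG predeqE => -[x y]; split.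
    move=> [/= [n _ Fnx] [k _ Gky]]; exists (maxn n k) => //; split.
    - by move: x Fnx; exact/subsetPset/ndF/leq_maxl.
    - by move: y Gky; exact/subsetPset/ndG/leq_maxr.
  by move=> [n _ []/= ? ?]; split; exists n.
move=> k; have [? ?] := Foo k; have [? ?] := Goo k.
split; first exact: measurableX.
by rewrite product_measure1E// lte_mul_pinfty// ge0_fin_numE.
Qed.

Definition tcons n (x : R * n.-tuple R) : n.+1.-tuple R := [tuple of x.1 :: x.2].
Definition tuncons n (t : n.+1.-tuple R) : R * n.-tuple R :=
  (thead t, [tuple of behead t]).

Lemma tconsK n : cancel (@tcons n) (@tuncons n).
Proof. by case=> x t; congr pair; apply/val_inj. Qed.

Lemma measurable_tcons n : measurable_fun setT (@tcons n).
Proof. exact: measurable_cons. Qed.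

Lemma measurable_tuncons n : measurable_fun setT (@tuncons n).
Proof.
apply: measurable_fun_pair; last exact: measurable_behead.
exact: measurable_tnth.
Qed.

Fixpoint tuple_lebesgue n : {sigma_finite_measure set (n.-tuple R) -> \bar R} :=
  match n with
  | 0%N => \d_ [tuple of [::]]
  | k.+1 => pushforward_can
      (product_sigma_finite (@lebesgue_measure R) (tuple_lebesgue k))
      (@measurable_tcons k) (@measurable_tuncons k) (@tconsK k)
  end.

Definition mx_of_tuple m n (t : (m * n).-tuple R) : 'M[R]_(m, n) :=
  \matrix_(i, j) tnth t (mxvec_index i j).
Definition tuple_of_mx m n (A : 'M[R]_(m, n)) : (m * n).-tuple R :=
  [tuple mxvec A ord0 k | k < m * n].

Lemma mx_of_tupleK m n : cancel (@mx_of_tuple m n) (@tuple_of_mx m n).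
Proof.
move=> t; apply/eq_from_tnth => k; rewrite tnth_mktuple.
by case/mxvec_indexP: k => i j; rewrite mxvecE mxE.
Qed.

Lemma measurable_mx_of_tuple m n : measurable_fun setT (@mx_of_tuple m n).
Proof.
apply/measurable_fun_mxP => i j; under eq_fun do rewrite mxE.
exact: measurable_tnth.
Qed.

Lemma measurable_tuple_of_mx m n : measurable_fun setT (@tuple_of_mx m n).
Proof.
apply/measurable_fun_tnthP; case/mxvec_indexP => i j.
rewrite (_ : _ \o _ = fun A : 'M[R]_(m, n) => A i j).
  exact: measurable_mx_entry.
by apply/funext => A /=; rewrite tnth_mktuple mxvecE.
Qed.

Definition mx_lebesgue m n : {sigma_finite_measure set 'M[R]_(m, n) -> \bar R} :=
  pushforward_can (sigma_finiteT (tuple_lebesgue (m * n)))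
    (@measurable_mx_of_tuple m n)
    (@measurable_tuple_of_mx m n) (@mx_of_tupleK m n).

Lemma tuple_lebesgue_box n (B : 'I_n -> set R) :
  (forall i, measurable (B i)) ->
  tuple_lebesgue n [set t | forall i, B i (tnth t i)] =
  \prod_(i < n) lebesgue_measure (B i).
Proof.
elim: n B => [|n IHn] B mB.
  rewrite big_ord0 /= (_ : [set t | _] = setT) ?diracT//.
  by apply/seteqP; split=> // t _ [].
rewrite big_ord_recl -IHn; last by move=> i; exact: mB.
rewrite -product_measure1E //; last first.
  rewrite (_ : [set t | _] = \bigcap_(i in [set: 'I_n])
      ((@tnth n R)^~ i @^-1` B (lift ord0 i))).
    apply: fin_bigcap_measurable => [|i _]; first exact: finite_finset.
    by rewrite -[X in measurable X]setTI; apply: measurable_tnth.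
  by apply/seteqP; split=> t /= h i; [move=> _|]; apply: h.
  exact: mB.
rewrite [LHS]/= /pushforward_can /pushforward. congr (product_measure1 _ _ _).
apply/seteqP; split=> -[x t] /= h.
  split=> [|i]; first by have := h ord0; rewrite tnth0.
  by have := h (lift ord0 i); rewrite tnthS.
move=> i; case: (unliftP ord0 i) => [j ->|->]; last by rewrite tnth0; case: h.
by rewrite tnthS; case: h => _; apply.
Qed.

Lemma mx_lebesgue_box m n (B : 'I_m -> 'I_n -> set R) :
  (forall i j, measurable (B i j)) ->
  mx_lebesgue m n [set A | forall i j, B i j (A i j)] =
  \prod_(i < m) \prod_(j < n) lebesgue_measure (B i j).
Proof.
move=> mB; pose ij := fun k => enum_val (cast_ord (esym (mxvec_cast m n)) k).
have ijE i j : ij (mxvec_index i j) = (i, j).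
  by rewrite /ij /mxvec_index cast_ordK enum_rankK.
rewrite pair_big /= (reindex ij)/=; last first.
  exists (fun p => mxvec_index p.1 p.2) => [k _|[i j] _]; last exact: ijE.
  by case/mxvec_indexP: k => i j; rewrite ijE.
rewrite -(@tuple_lebesgue_box _ (fun k => B (ij k).1 (ij k).2)); last first.
  by move=> k; exact: mB.
rewrite /= /pushforward_can /pushforward; congr (tuple_lebesgue _ _).
apply/seteqP; split=> t /= h.
  by case/mxvec_indexP => i j; rewrite ijE; have := h i j; rewrite mxE.
by move=> i j; have := h (mxvec_index i j); rewrite ijE mxE.
Qed.
End lebesgue_matrix.
Arguments mx_lebesgue {R} m n.

Section sphere.
Context {R : realType}.
Variable n : nat.
Implicit Types x : 'cV[R]_n.

(* `|x| on matrices is the maximum norm, so the Euclidean one is spelled out. *)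
Definition enorm x : R := Num.sqrt (\sum_(a < n) x a ord0 ^+ 2)%R.

Definition unit_ball : set 'cV[R]_n := [set x | (enorm x <= 1)%R].
Definition unit_sphere : set 'cV[R]_n := [set x | enorm x = 1%R].
Definition normalize x : 'cV[R]_n := ((enorm x)^-1 *: x)%R.

Lemma measurable_enorm : measurable_fun setT enorm.
Proof.
rewrite (_ : enorm = fun x => ((\sum_(a < n) x a ord0 ^+ 2) `^ 2^-1)%R).
  apply: (measurableT_comp (@measurable_powR R 2^-1)).
  apply: measurable_sum => a.
  by apply: measurable_funX; exact: measurable_mx_entry.
apply/funext => x; rewrite powR12_sqrt//.
by apply: sumr_ge0 => a _; exact: sqr_ge0.
Qed.

Lemma measurable_unit_ball : measurable unit_ball.
Proof.
rewrite (_ : unit_ball = enorm @^-1` `]-oo, 1%R]).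
  rewrite -[X in measurable X]setTI; exact: measurable_enorm.
by apply/seteqP; split=> x /=; rewrite in_itv.
Qed.

Lemma measurable_unit_sphere : measurable unit_sphere.
Proof.
rewrite -[X in measurable X]setTI.
exact: (measurable_enorm _ (measurable_set1 1%R)).
Qed.

Lemma measurable_normalize : measurable_fun setT normalize.
Proof.
apply/measurable_fun_mxP => a b.
rewrite (_ : (fun x => _) = fun x => (enorm x `^ (-1) * x a b)%R).
  apply: measurable_funM; last exact: measurable_mx_entry.
  exact: (measurableT_comp (@measurable_powR R (-1)) measurable_enorm).
by apply/funext => x; rewrite mxE powR_inv1 ?sqrtr_ge0.
Qed.

(* Surface measure of the unit sphere: the area of A is n times the volume of
   the cone {t e : e in A, 0 <= t <= 1}. *)
Definition sphere_measure (A : set 'cV[R]_n) : \bar R :=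
  (n%:R : R)%:E * mx_lebesgue n 1 (normalize @^-1` A `&` unit_ball).

Let ball_measure := mrestr (mx_lebesgue n 1) measurable_unit_ball.
Let cone_measure : {measure set 'cV[R]_n -> \bar R}.
Proof.
unshelve refine (pushforward ball_measure normalize
  : {measure set 'cV[R]_n -> \bar R}).
exact: measurable_normalize.
Defined.

HB.instance Definition _ :=
  Measure.copy sphere_measure (mscale (NngNum (ler0n R n)) cone_measure).

Definition sphere_area : R := fine (sphere_measure unit_sphere).

End sphere.

Section superharmonic.
Context {R : realType}.
Variables n p : nat.
Implicit Types f : 'M[R]_(n, p) -> \bar R.

Definition sphere_mean f (X : 'M[R]_(n, p)) (rho : 'cV[R]_p) : \bar R :=
  ((@sphere_area R n)^-1)%:E *
  \int[@sphere_measure R n]_(e in @unit_sphere R n) f (X + e *m rho^T)%R.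

Definition matrix_superharmonic f : Prop :=
  [/\ forall X, f X != -oo,
      lower_semicontinuous f,
      exists X, f X != +oo
    & forall X rho, sphere_mean f X rho <= f X].

End superharmonic.

Section bayes.
Context {R : realType}.
Variables n p : nat.
Implicit Types (M X : 'M[R]_(n, p)) (pi : 'M[R]_(n, p) -> \bar R).

Definition mxnormal_pdf M X : R :=
  (\prod_(a < n) \prod_(i < p) normal_pdf (M a i) 1 (X a i))%R.

Definition expect M (f : 'M[R]_(n, p) -> R) : \bar R :=
  \int[mx_lebesgue n p]_X (f X * mxnormal_pdf M X)%:E.

Definition quad_loss M Mhat : 'M[R]_p := ((Mhat - M)^T *m (Mhat - M))%R.

Definition quad_form (A : 'M[R]_p) (c : 'cV[R]_p) : R :=
  (c^T *m A *m c)%R ord0 ord0.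

(* c^T R(M, Mhat) c in [0, +oo]: taking the expectation after the quadratic
   form keeps it meaningful when the entries of the risk matrix are not. *)
Definition quad_risk (Mhat : 'M[R]_(n, p) -> 'M[R]_(n, p)) M (c : 'cV[R]_p) :
  \bar R := expect M (fun X => quad_form (quad_loss M (Mhat X)) c).

Definition sup_risk Mhat c : \bar R :=
  ereal_sup [set quad_risk Mhat M c | M in [set: 'M[R]_(n, p)]].

Definition estimator (Mhat : 'M[R]_(n, p) -> 'M[R]_(n, p)) : Prop :=
  measurable_fun setT Mhat.

Definition minimax Mhat : Prop :=
  estimator Mhat /\
  forall c, sup_risk Mhat c =
    ereal_inf [set sup_risk Mhat' c | Mhat' in [set T | estimator T]].

Definition prior pi : Prop :=
  [/\ forall M, 0 <= pi M,
      measurable_fun setT pi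
    & ~ {ae mx_lebesgue n p, forall M, pi M = 0}].

Definition marginal pi X : \bar R :=
  \int[mx_lebesgue n p]_M ((mxnormal_pdf M X)%:E * pi M).

Definition log_marginal pi X : R := ln (fine (marginal pi X)).

Definition gen_bayes pi X : 'M[R]_(n, p) :=
  \matrix_(a, i) (fine (\int[mx_lebesgue n p]_M
    ((M a i * mxnormal_pdf M X)%:E * pi M)) / fine (marginal pi X))%R.

Definition mx_gradient (f : 'M[R]_(n, p) -> R) X : 'M[R]_(n, p) :=
  \matrix_(a, i) 'D_(delta_mx a i) f X.

End bayes.

(* Main.v *)
(* The minimax risk at c is n |c|^2. The lower bound is the limit of the Bayes
   risks n |c|^2 / (1 + t^-2) of the Gaussian priors N(0, t^2).

   For the upper bound let m be the marginal, G_a = (grad log m . c)_a, and let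
   D_a be differentiation along e_a c^T. Averaging the superharmonicity of pi
   against the Gaussian kernel and using cosh y >= 1 + y^2 / 2 gives, as the
   radius tends to 0, that the posterior mean of |(X - M) c|^2 is at most
   n |c|^2, that is sum_a D_a^2 m <= 0. By Cauchy-Schwarz this also makes G_a
   and D_a G_a bounded, so that the Stein identity E[U_a G_a] = E[D_a G_a], where
   U = (X - M) c, needs no further integrability condition. Hence
     E|U + G|^2 = n |c|^2 + E[sum_a (2 D_a G_a + G_a^2)]
                = n |c|^2 + E[2 sum_a D_a^2 m / m - |G|^2] <= n |c|^2.
   The Stein identity itself is the derivative at t = 0 of the translation
   invariance of the Lebesgue integral. *)
Require Import Defs.
From HB Require Import structures.
From mathcomp Require Import all_boot all_order all_algebra all_fingroup.
From mathcomp Require Import all_classical all_reals all_analysis.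
From mathcomp Require Import measurable_realfun ring lra.
Set Implicit Arguments.
Unset Strict Implicit.
Unset Printing Implicit Defensive.
Import Order.TTheory GRing.Theory Num.Theory.
Import numFieldNormedType.Exports.

Local Open Scope classical_set_scope.
Local Open Scope ring_scope.

(** * Invariance of the Lebesgue measure on matrices *)

(** The prior may be infinite or non-smooth, so it is never differentiated. The spherical mean
    inequality is used at radius r as it stands, and Tonelli with translation invariance moves the
    average from the prior to the Gaussian kernel. There the sphere costs a factor exp(-r^2 |c|^2 /
    2), and cosh gains r^2 |(X - M) c|^2 / (2 n), since the mean of e_a^2 is 1/n. Balancing the
    terms of order r^2 gives exactly the constant n |c|^2.

    All calculus is one-dimensional. Moving X to X + t Z multiplies the posterior weight by an
    exponential in t, so the marginal along a line is an explicit Gaussian factor times a Laplace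
    transform, and finiteness of the marginal everywhere supplies every exponential moment. One
    Stein identity serves both bounds: on the posterior of M under a Gaussian prior for the lower
    one, on the law of X for the upper one. *)

Section measure_preserving.
Context d (T : measurableType d) (R : realType).
Variables (mu : {measure set T -> \bar R}) (phi : T -> T).
Hypothesis mphi : measurable_fun setT phi.
Hypothesis mu_phi : forall A, measurable A -> mu (phi @^-1` A) = mu A.

Lemma ge0_integral_preserving (f : T -> \bar R) :
  measurable_fun setT f -> (forall x, 0 <= f x)%E ->
  (\int[mu]_x f (phi x) = \int[mu]_x f x)%E.
Proof.
move=> mf f0.
transitivity (\int[pushforward mu phi]_x f x)%E.
  by rewrite (ge0_integral_pushforward mphi).
pose nu : {measure set T -> \bar R} := ltac:(
  unshelve refine (pushforward mu phi : {measure set T -> \bar R}); exact: mphi).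
by apply: (@eq_measure_integral _ _ _ _ mu nu) => A mA _; rewrite -[RHS]mu_phi.
Qed.

Lemma integral_preserving (f : T -> \bar R) : measurable_fun setT f ->
  (\int[mu]_x f (phi x) = \int[mu]_x f x)%E.
Proof.
move=> mf; rewrite integralE [RHS]integralE.
have p := ge0_integral_preserving (measurable_funepos mf) (funepos_ge0 f).
have n := ge0_integral_preserving (measurable_funeneg mf) (funeneg_ge0 f).
by rewrite -p -n; congr (_ - _)%E; apply: eq_integral => x _;
  rewrite (funepos_comp f phi, funeneg_comp f phi).
Qed.

Lemma integrable_preserving (f : T -> \bar R) :
  mu.-integrable setT f -> mu.-integrable setT (f \o phi).
Proof.
move=> /integrableP[mf foo]; apply/integrableP; split.
  exact: measurableT_comp.
rewrite /= (@ge0_integral_preserving (fun x => `|f x|%E))//.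
exact: measurableT_comp.
Qed.

End measure_preserving.

Section mx_lebesgue_invariance.
Context {R : realType}.
Variables m n : nat.

Definition mx_box (B : 'I_m -> 'I_n -> set R) : set 'M[R]_(m, n) :=
  [set A | forall i j, B i j (A i j)].

Lemma measurable_mx_box B : (forall i j, measurable (B i j)) ->
  measurable (mx_box B).
Proof.
move=> mB.
rewrite (_ : mx_box B = \bigcap_(ij in [set: 'I_m * 'I_n])
    ((fun A : 'M[R]_(m, n) => A ij.1 ij.2) @^-1` B ij.1 ij.2)).
  apply: fin_bigcap_measurable => [|[i j] _ /=]; first exact: finite_finset.
  by rewrite -[X in measurable X]setTI; apply: measurable_mx_entry.
by apply/seteqP; split=> [A AB [i j] _|A AB i j]; [exact: AB|exact: (AB (i, j))].
Qed.

(** Boxes are stable under intersection and generate the sigma-algebra, and the cubes [-k, k]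
    exhaust the space with finite measure, so the uniqueness theorem for measures on a pi-system
    applies. *)
Lemma mx_lebesgue_unique (nu : {measure set 'M[R]_(m, n) -> \bar R}) :
  (forall B, (forall i j, measurable (B i j)) ->
    nu (mx_box B) = mx_lebesgue m n (mx_box B)) ->
  forall A, measurable A -> nu A = mx_lebesgue m n A.
Proof.
move=> nuE A mA; apply/esym.
pose G := [set C | exists2 B : 'I_m -> 'I_n -> set R,
   forall i j, measurable (B i j) & C = mx_box B].
apply: (g_sigma_algebra_measure_unique G _
  (fun k => mx_box (fun _ _ => [set` `[- k%:R, k%:R]]))) => //.
- by move=> _ [B mB ->]; exact: measurable_mx_box.
- by move=> k; exists (fun _ _ => [set` `[- k%:R, k%:R]]) => // i j; exact: measurable_itv.
- apply/seteqP; split=> // C _.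
  exists (\max_(i < m) \max_(j < n) Num.truncn `|C i j|).+1 => // i j /=.
  rewrite in_itv/= -ler_norml; apply: ltW.
  have := truncnS_gt `|C i j|; move/lt_le_trans; apply; rewrite ler_nat ltnS.
  apply: leq_trans (leq_bigmax i).
  exact: (leq_bigmax (F := fun j => Num.truncn `|C i j|)).
- move=> _ _ [B mB ->] [C mC ->]; exists (fun i j => B i j `&` C i j).
    by move=> i j; exact: measurableI.
  apply/seteqP; split=> [D [DB DC] i j|D BCD]; first by split.
  by split=> i j; have [] := BCD i j.
- by move=> _ [B mB ->]; rewrite nuE.
- move=> k.
  have := @mx_lebesgue_box R m n (fun _ _ => [set` `[- k%:R, k%:R]])
    (fun _ _ => measurable_itv _).
  move=> h; rewrite [ltLHS]h.
  rewrite -ge0_fin_numE; last by do 2 (apply: prode_ge0 => ? _).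
  do 2 (apply: prode_fin_num => ? _); rewrite lebesgue_measure_itv/=.
  by case: ifP.
(* Boxes generate: a constraint on one entry is the box whose other sides are the whole line. *)
move: A mA; apply: smallest_sub; first exact: smallest_sigma_algebra.
move=> _ [[i j] _ [B mB <-]]; apply: sub_sigma_algebra.
exists (fun i' j' => if (i' == i) && (j' == j) then B else setT).
  by move=> i' j'; case: ifP.
rewrite setTI; apply/seteqP; split=> [A AB i' j'|A AB /=].
  by case: ifP => // /andP[/eqP-> /eqP->].
by have := AB i j; rewrite !eqxx.
Qed.

Section entrywise.
Variables (s : 'S_m) (phi : 'I_m -> 'I_n -> R -> R).
Hypothesis mphi : forall i j, measurable_fun setT (phi i j).
Hypothesis leb_phi : forall i j (A : set R), measurable A ->
  lebesgue_measure (phi i j @^-1` A) = lebesgue_measure A.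

(** This class contains both symmetries needed later: translations ([s] the identity) and signed
    permutations of the coordinates of a column. *)
Definition mx_entrywise (A : 'M[R]_(m, n)) : 'M[R]_(m, n) :=
  \matrix_(i, j) phi i j (A (s i) j).

Lemma measurable_mx_entrywise : measurable_fun setT mx_entrywise.
Proof.
apply/measurable_fun_mxP => i j; under eq_fun do rewrite mxE.
by apply: measurableT_comp => //; exact: measurable_mx_entry.
Qed.

(** The preimage of a box is again a box, with sides pulled back by [phi] and rows permuted, so
    invariance reduces to that of length on the line. *)
Lemma mx_lebesgue_entrywise A : measurable A ->
  mx_lebesgue m n (mx_entrywise @^-1` A) = mx_lebesgue m n A.
Proof.
move: A; pose nu : {measure set 'M[R]_(m, n) -> \bar R} := ltac:(
  unshelve refine (pushforward (mx_lebesgue m n) mx_entrywise :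
    {measure set 'M[R]_(m, n) -> \bar R}); exact: measurable_mx_entrywise).
apply: (mx_lebesgue_unique (nu := nu)) => B mB.
have mpB i j : measurable (phi i j @^-1` B i j).
  by rewrite -[X in measurable X]setTI; apply: mphi.
transitivity (mx_lebesgue m n (mx_box
  (fun i j => phi ((s^-1)%g i) j @^-1` B ((s^-1)%g i) j))).
  congr (mx_lebesgue m n _); apply/seteqP; split=> A AB i j /=.
    by have := AB ((s^-1)%g i) j; rewrite mxE permKV.
  by rewrite mxE; have := AB (s i) j; rewrite /= permK.
etransitivity; first exact: mx_lebesgue_box.
etransitivity; last by apply/esym/mx_lebesgue_box.
rewrite [LHS](reindex_perm s); apply: eq_bigr => i _; apply: eq_bigr => j _.
by rewrite permK leb_phi.
Qed.

End entrywise.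

End mx_lebesgue_invariance.

Lemma lebesgue_measure_translation (R : realType) (a : R) (A : set R) :
  measurable A -> lebesgue_measure ((fun x => x + a) @^-1` A) = lebesgue_measure A.
Proof.
move=> mA; pose nu : {measure set (measurableTypeR R) -> \bar R} := ltac:(
  unshelve refine (pushforward lebesgue_measure
    ((fun x => x + a) : measurableTypeR R -> measurableTypeR R) :
    {measure set (measurableTypeR R) -> \bar R});
  exact: measurable_funD).
rewrite [RHS](lebesgue_measure_unique (mu := nu))// => _ [[x y]] _ <-.
rewrite /nu/= /pushforward/=.
rewrite (_ : _ @^-1` _ = `]x - a, y - a]%classic); last first.
  by apply/seteqP; split=> z /=; rewrite !in_itv/= ltrBlDr lerBrDr.
rewrite !lebesgue_measure_itv/= !lte_fin ltrD2r; case: ifP => // _.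
by rewrite -!EFinB opprB addrA subrK.
Qed.

Section translation.
Context {R : realType} (m n : nat).
Implicit Types Z : 'M[R]_(m, n).

Lemma measurable_mx_shift Z : measurable_fun setT (fun A : 'M[R]_(m, n) => A + Z).
Proof.
apply/measurable_fun_mxP => i j; under eq_fun do rewrite mxE.
by apply: measurable_funD => //; exact: measurable_mx_entry.
Qed.

Lemma mx_lebesgue_shift Z A : measurable A ->
  mx_lebesgue m n ((fun X : 'M[R]_(m, n) => X + Z) @^-1` A) = mx_lebesgue m n A.
Proof.
move=> mA; rewrite -[RHS](mx_lebesgue_entrywise 1%g
  (phi := fun i j x => x + Z i j))//; last 2 first.
- by move=> i j; exact: measurable_funD.
- by move=> i j B; exact: lebesgue_measure_translation.
congr (mx_lebesgue m n _); apply/seteqP; split=> X /=;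
by rewrite (_ : X + Z = mx_entrywise 1 (fun i j x => x + Z i j) X)//;
   apply/matrixP => i j; rewrite !mxE perm1.
Qed.

Lemma integral_mx_shift Z (f : 'M[R]_(m, n) -> \bar R) : measurable_fun setT f ->
  (\int[mx_lebesgue m n]_X f (X + Z)%R = \int[mx_lebesgue m n]_X f X)%E.
Proof.
move=> mf; apply: (integral_preserving (phi := fun X : 'M[R]_(m, n) => X + Z)) => //.
- exact: measurable_mx_shift.
- exact: mx_lebesgue_shift.
Qed.

Lemma integrable_mx_shift Z (f : 'M[R]_(m, n) -> \bar R) :
  (mx_lebesgue m n).-integrable setT f ->
  (mx_lebesgue m n).-integrable setT (fun X => f (X + Z)).
Proof.
move=> intf; apply: (integrable_preserving (phi := fun X : 'M[R]_(m, n) => X + Z)) => //.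
- exact: measurable_mx_shift.
- exact: mx_lebesgue_shift.
Qed.

End translation.

(** * Integrals of products of functions of single entries *)

Section tensor.
Context {R : realType}.
Local Open Scope ereal_scope.

Lemma integral_pushforward_can d1 d2 (T1 : measurableType d1)
    (T2 : measurableType d2) (mu : {measure set T1 -> \bar R})
    (f : T1 -> T2) (g : T2 -> T1) (smu : sigma_finite setT mu)
    (mf : measurable_fun setT f) (mg : measurable_fun setT g)
    (fK : cancel f g) (h : T2 -> \bar R) :
  measurable_fun setT h -> (forall y, 0 <= h y) ->
  \int[pushforward_can smu mf mg fK]_y h y = \int[mu]_x h (f x).
Proof. by move=> mh h0; rewrite (ge0_integral_pushforward mf). Qed.

Lemma integral_tuple_prod n (f : 'I_n -> R -> R) :
  (forall i, measurable_fun setT (f i)) -> (forall i x, (0 <= f i x)%R) ->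
  \int[tuple_lebesgue n]_t (\prod_(i < n) f i (tnth t i))%:E =
  \prod_(i < n) \int[lebesgue_measure]_x (f i x)%:E.
Proof.
elim: n f => [|n IHn] f mf f0.
  rewrite big_ord0 /= integral_dirac//=.
    by rewrite big_ord0 mule1; exact: diracT.
  by under eq_fun do rewrite big_ord0; exact: measurable_cst.
have mprod k (g : 'I_k -> R -> R) : (forall i, measurable_fun setT (g i)) ->
    measurable_fun setT (fun t : k.-tuple R => \prod_(i < k) g i (tnth t i))%R.
  move=> mg; apply: measurable_prod => i _.
  by apply: measurableT_comp => //; exact: measurable_tnth.
etransitivity.
  apply: integral_pushforward_can.
  - by apply/measurable_EFinP; exact: mprod.
  - by move=> t; rewrite lee_fin prodr_ge0.
etransitivity.
  apply: fubini_tonelli1 => [|t]; last by rewrite lee_fin prodr_ge0.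
  by apply/measurable_EFinP; apply: (measurableT_comp (mprod _ _ mf));
    exact: measurable_tcons.
rewrite big_ord_recl -IHn//.
set C := (X in _ = _ * X).
have C0 : 0 <= C by apply: integral_ge0 => t _; rewrite lee_fin prodr_ge0.
transitivity (\int[lebesgue_measure]_x ((f ord0 x)%:E * C)); last first.
  apply: ge0_integralZr => //; first by apply/measurable_EFinP; exact: mf.
  by move=> x _; rewrite lee_fin.
apply: eq_integral => x _; rewrite /fubini_F/= -ge0_integralZl//; last 3 first.
- apply/measurable_EFinP.
  exact: (mprod _ _ (fun i => mf (lift ord0 i))).
- by move=> t _; rewrite lee_fin prodr_ge0.
- by rewrite lee_fin.
apply: eq_integral => t _; rewrite big_ord_recl tnth0 EFinM.
by under eq_bigr do rewrite tnthS.
Qed.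

Lemma integral_mx_prod m n (f : 'I_m -> 'I_n -> R -> R) :
  (forall i j, measurable_fun setT (f i j)) ->
  (forall i j x, (0 <= f i j x)%R) ->
  \int[mx_lebesgue m n]_A (\prod_(i < m) \prod_(j < n) f i j (A i j))%:E =
  \prod_(i < m) \prod_(j < n) \int[lebesgue_measure]_x (f i j x)%:E.
Proof.
move=> mf f0; pose ij := fun k => enum_val (cast_ord (esym (mxvec_cast m n)) k).
have ijE i j : ij (mxvec_index i j) = (i, j).
  by rewrite /ij /mxvec_index cast_ordK enum_rankK.
have bij : {on [pred i | xpredT i], bijective ij}.
  exists (fun p => mxvec_index p.1 p.2) => [k _|[i j] _]; last exact: ijE.
  by case/mxvec_indexP: k => i j; rewrite ijE.
rewrite pair_big /= (reindex ij)//=.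
rewrite -(@integral_tuple_prod _ (fun k => f (ij k).1 (ij k).2))//.
etransitivity.
  apply: integral_pushforward_can.
- apply/measurable_EFinP; apply: measurable_prod => i _.
  apply: measurable_prod => j _; apply: measurableT_comp => //.
  exact: measurable_mx_entry.
- by move=> A; rewrite lee_fin; do 2 (apply: prodr_ge0 => ? _).
apply: eq_integral => t _ /=; congr EFin.
rewrite pair_big /= (reindex ij)//=; apply: eq_bigr => k _.
by case/mxvec_indexP: k => i j; rewrite mxE ijE.
Qed.

End tensor.

(** * Elementary inequalities *)

Section elementary.
Context {R : realType}.
Implicit Types x y t : R.

Lemma MVT_everywhere (f df : R -> R) a b : a <= b ->
  (forall x, is_derive x 1 f (df x)) ->
  exists2 c, c \in `[a, b]%R & f b - f a = df c * (b - a).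
Proof.
move=> ab fdf; apply: MVT_segment => //.
apply: continuous_subspaceT => x.
by apply: differentiable_continuous; apply/derivable1_diffP; case: (fdf x).
Qed.

(** The square of exp(t/2) - exp(-t/2) is nonnegative. *)
Lemma expRDexpRN_ge2 t : 2 <= expR t + expR (- t).
Proof.
have := sqr_ge0 (expR (t / 2) - expR (- (t / 2))).
rewrite sqrrB -!expRM_natl -expRD subrr expR0.
rewrite (_ : 2%:R * (t / 2) = t); last by field.
by rewrite (_ : 2%:R * - (t / 2) = - t); [lra|field].
Qed.

Lemma expRBexpRN_ge t : 0 <= t -> 2 * t <= expR t - expR (- t).
Proof.
move=> t0; pose f (x : R) := expR x - expR (- x) - 2 * x.
have df (x : R) : is_derive x 1 f (expR x + expR (- x) - 2).
  by rewrite /f; apply: is_derive_eq; rewrite /GRing.scale/=; ring.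
have [c _] := MVT_everywhere t0 df.
have := mulr_ge0 (_ : 0 <= expR c + expR (- c) - 2) t0.
rewrite subr_ge0 => /(_ (expRDexpRN_ge2 c)).
by rewrite /f !oppr0 expR0; lra.
Qed.

(* Squaring 2 sinh (y / 2) >= y. *)
Lemma expRDexpRN_ge y : 2 + y ^+ 2 <= expR y + expR (- y).
Proof.
wlog y0 : y / 0 <= y => [H|].
  have [/H//|/ltW yn] := leP 0 y; have := H (- y).
  by rewrite sqrrN opprK oppr_ge0 [expR (- y) + _]addrC; exact.
have h := @expRBexpRN_ge (y / 2); have := h (ltac:(lra)) => {}h.
have := lerXn2r 2 (_ : 2 * (y / 2) \in Num.nneg) _ h.
rewrite !nnegrE; have y2 : 2 * (y / 2) = y by field.
rewrite y2 y0 (le_trans _ h) ?y2// => /(_ isT isT).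
rewrite sqrrB -!expRM_natl -expRD subrr expR0 y2.
by rewrite (_ : 2%:R * - (y / 2) = - y); [lra|field].
Qed.

(** The tangent bound 1 + z <= exp z at z = y and z = - y suffices. This bound and the next hold for
    every y, because the exponents they are applied to are unbounded; the growth is absorbed by
    exponential moments. *)
Lemma expRB1_le_norm y : `|expR y - 1| <= `|y| * expR `|y|.
Proof.
have h1 := expR_ge1Dx y; have h2 := expR_ge1Dx (- y).
have h3 : expR y - 1 <= y * expR y.
  have := ler_wpM2l (expR_ge0 y) h2; rewrite -expRD subrr expR0; lra.
have [y0|y0] := leP 0 y.
  by rewrite ger0_norm ?(ger0_norm y0)//; lra.
rewrite (ltr0_norm y0) ltr0_norm; last by rewrite subr_lt0 expR_lt1.
have : 1 <= expR (- y) by rewrite -expR0 ler_expR; lra.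
move: (ltW y0); rewrite -oppr_ge0 => yn /(ler_wpM2l yn); lra.
Qed.

Lemma expRB1B_le_norm y : `|expR y - 1 - y| <= y ^+ 2 * expR `|y|.
Proof.
have h1 := expR_ge1Dx y; have h2 := expR_ge1Dx (- y).
have h3 : expR y - 1 <= y * expR y.
  have := ler_wpM2l (expR_ge0 y) h2; rewrite -expRD subrr expR0; lra.
have h4 := expRB1_le_norm y.
rewrite ger0_norm; last lra.
(* The difference of the two sides is 1 - exp y + y exp y, nonnegative by [h3]. *)
apply: (@le_trans _ _ (y * (expR y - 1))); first lra.
apply: (le_trans (ler_norm _)); rewrite normrM -real_normK ?num_real//.
by rewrite expr2 -mulrA ler_wpM2l.
Qed.

End elementary.

(** * Averages over the sphere *)

Section Rintegral_sum.
Context d (T : measurableType d) (R : realType).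
Variables (mu : {measure set T -> \bar R}) (D : set T) (mD : measurable D).
Variables (I : Type) (r : seq I) (f : I -> T -> R).
Hypothesis intf : forall i, mu.-integrable D (fun x => (f i x)%:E).

Lemma integrable_Rsum : mu.-integrable D (fun x => (\sum_(i <- r) f i x)%:E).
Proof.
apply: (eq_integrable mD (fun x => (\sum_(i <- r) (f i x)%:E)%E)).
  by move=> x _; rewrite sumEFin.
by apply: integrable_sum => // i _; exact: intf.
Qed.

Lemma Rintegral_sum :
  \int[mu]_(x in D) (\sum_(i <- r) f i x) = \sum_(i <- r) \int[mu]_(x in D) f i x.
Proof.
rewrite /Rintegral sum_fine => [|i _]; last first.
  by apply: integrable_fin_num => //; exact: intf.
congr fine; under eq_integral do rewrite -sumEFin.
by apply: (integral_sum mD) => i; exact: intf.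
Qed.

End Rintegral_sum.

Lemma ge0_integral_mrestr d (T : measurableType d) (R : realType)
    (mu : {measure set T -> \bar R}) (B D : set T) (mB : measurable B)
    (f : T -> \bar R) :
  measurable D -> measurable_fun D f -> (forall x, D x -> 0 <= f x)%E ->
  (\int[mrestr mu mB]_(x in D) f x = \int[mu]_(x in D `&` B) f x)%E.
Proof.
move=> mD mf f0.
rewrite (@ge0_negligible_integral _ _ _ (mrestr mu mB) D (~` B))//.
- rewrite setDE setCK; apply: (@eq_measure_integral _ _ _ _ mu (mrestr mu mB)).
  by move=> A _ AB; rewrite /= /mrestr setIidl// => x /AB[].
- exact: measurableC.
- by rewrite /= /mrestr setICl measure0.
Qed.

Section sphere_integral.
Context {R : realType} (n : nat).
Hypothesis n0 : (0 < n)%N.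
Local Notation V := 'cV[R]_n.
Local Notation mu := (mx_lebesgue n 1 : {measure set 'cV[R]_n -> \bar R}).
Implicit Types (x e : V).

(* The unit ball minus the origin (where [normalize] takes the junk value 0);
   integrals over the sphere become integrals of [f \o normalize] over it. *)
Definition sphere_cone : set V :=
  @normalize R n @^-1` @unit_sphere R n `&` @unit_ball R n.

Lemma measurable_sphere_cone : measurable sphere_cone.
Proof.
apply: measurableI; last exact: measurable_unit_ball.
rewrite -[X in measurable X]setTI.
exact: (@measurable_normalize R n measurableT _ (@measurable_unit_sphere R n)).
Qed.
Local Notation mC := measurable_sphere_cone.

Lemma enorm_sum_sqr x : enorm x ^+ 2 = \sum_a x a ord0 ^+ 2.
Proof. by rewrite sqr_sqrtr// sumr_ge0// => a _; exact: sqr_ge0. Qed.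

Lemma normalize_sphere x : enorm x != 0 -> enorm (normalize x) = 1.
Proof.
move=> x0; apply/eqP; rewrite -(@eqrXn2 _ 2)// ?sqrtr_ge0// enorm_sum_sqr.
under eq_bigr do rewrite mxE exprMn.
by rewrite -mulr_sumr -enorm_sum_sqr -exprMn mulVf.
Qed.

(** The surface measure is n times the image under [normalize] of the volume on the ball, so the
    integral is unwound through scaling, pushforward and restriction in turn. *)
Lemma ge0_integral_sphere (f : V -> \bar R) :
  measurable_fun setT f -> (forall e, 0 <= f e)%E ->
  (\int[@sphere_measure R n]_(e in @unit_sphere R n) f e =
   n%:R%:E * \int[mu]_(x in sphere_cone) f (normalize x))%E.
Proof.
move=> mf f0.
pose nu := mrestr mu (@measurable_unit_ball R n).
pose nu' : {measure set V -> \bar R} := ltac:(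
  unshelve refine (pushforward nu (@normalize R n) : {measure set V -> \bar R});
  exact: measurable_normalize).
have mS := @measurable_unit_sphere R n.
transitivity (\int[mscale (NngNum (ler0n R n)) nu']_(e in @unit_sphere R n) f e)%E.
  exact: (@eq_measure_integral _ _ _ _ (mscale (NngNum (ler0n R n)) nu')).
rewrite ge0_integral_mscale//; last exact: measurable_funS mf.
congr (_ * _)%E.
transitivity (\int[pushforward nu (@normalize R n)]_(e in @unit_sphere R n) f e)%E.
  by [].
rewrite (ge0_integral_pushforward (@measurable_normalize R n))//; last first.
  exact: measurable_funS mf.
have mN : measurable (@normalize R n @^-1` @unit_sphere R n).
  by rewrite -[X in measurable X]setTI; exact: measurable_normalize.
rewrite ge0_integral_mrestr// => [|x _]; last exact: f0.
exact: (measurable_funTS (measurableT_comp mf (@measurable_normalize R n))).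
Qed.

Lemma sphere_cone_lty : (mu sphere_cone < +oo)%E.
Proof.
pose I : set R := `[-1, 1]%classic.
have mB : forall (i : 'I_n) (j : 'I_1), measurable I.
  by move=> i j; exact: measurable_itv.
apply: (@le_lt_trans _ _ (mu (mx_box (fun _ _ => I)))).
  apply: le_measure; rewrite ?inE; first exact: mC.
    exact: measurable_mx_box.
  move=> x [_ xB] i j; rewrite ord1 /I/= in_itv/= -ler_norml.
  rewrite -(@ler_pXn2r _ 2) ?nnegrE// real_normK ?num_real//.
  apply: (@le_trans _ _ (enorm x ^+ 2)); last by rewrite lerXn2r ?nnegrE ?sqrtr_ge0.
  rewrite enorm_sum_sqr (bigD1 i)//= lerDl sumr_ge0// => a _; exact: sqr_ge0.
have -> : mu (mx_box (fun _ _ => I)) =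
    (\prod_(i < n) \prod_(j < 1) lebesgue_measure I)%E.
  exact: mx_lebesgue_box.
rewrite -ge0_fin_numE; last by do 2 (apply: prode_ge0 => ? _).
do 2 (apply: prode_fin_num => ? _); rewrite lebesgue_measure_itv/=.
by case: ifP.
Qed.

Lemma sphere_cone_gt0 : (0 < mu sphere_cone)%E.
Proof.
have nR : 0 < n%:R :> R by rewrite ltr0n.
have n2 : (2 * n%:R)^-1 < n%:R^-1 :> R.
  by rewrite ltf_pV2 ?posrE ?mulr_gt0// ltr_pMl// ltr1n.
(* A cube inside the cone: the positive lower end keeps x away from the origin, and the upper end
   gives x_a^2 <= x_a <= 1/n, so the squares sum to at most 1. *)
pose I : set R := `[(2 * n%:R)^-1, n%:R^-1]%classic.
have mB : forall (i : 'I_n) (j : 'I_1), measurable I.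
  by move=> i j; exact: measurable_itv.
apply: (@lt_le_trans _ _ (mu (mx_box (fun _ _ => I)))); last first.
  apply: le_measure; rewrite ?inE; last 2 first.
  - exact: mC.
  - move=> x xI.
    have xa a : 0 < x a ord0 <= n%:R^-1.
      have := xI a ord0; rewrite /I/= in_itv/= => /andP[h ->]; rewrite andbT.
      by apply: lt_le_trans h; rewrite invr_gt0 mulr_gt0.
    have x2 : 0 < enorm x ^+ 2 <= 1.
      rewrite enorm_sum_sqr; apply/andP; split.
        rewrite (bigD1 (Ordinal n0))//= ltr_wpDr//.
          by rewrite sumr_ge0// => a _; exact: sqr_ge0.
        by rewrite exprn_gt0//; case/andP: (xa (Ordinal n0)).
      apply: (@le_trans _ _ (\sum_(a < n) n%:R^-1)); last first.
        by rewrite sumr_const card_ord -[leLHS]mulr_natr mulVf ?gt_eqF.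
      apply: ler_sum => a _; case/andP: (xa a) => xa0 xan.
      apply: (@le_trans _ _ (x a ord0)) => //; rewrite expr2 ger_pMl//.
      by rewrite (le_trans xan)// invf_le1// ler1n.
    case/andP: x2 => x20 x21; split.
      by apply: normalize_sphere; rewrite -sqrf_eq0 gt_eqF.
    by rewrite /unit_ball/= -(@ler_pXn2r _ 2) ?nnegrE ?sqrtr_ge0// expr1n.
  exact: measurable_mx_box.
have -> : mu (mx_box (fun _ _ => I)) =
    (\prod_(i < n) \prod_(j < 1) lebesgue_measure I)%E.
  exact: mx_lebesgue_box.
rewrite lebesgue_measure_itv/= lte_fin n2 -EFinB.
under eq_bigr do rewrite prodEFin.
rewrite prodEFin lte_fin; do 2 (apply: prodr_gt0 => ? _).
by rewrite subr_gt0.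
Qed.

(** These isometries permute coordinates and flip signs; they determine the second moments of the
    sphere without any appeal to general rotations. *)
Definition signed_perm (s : 'S_n) (eps : 'I_n -> bool) x : V :=
  \col_a ((-1) ^+ eps a * x (s a) ord0).

Lemma signed_permE s eps :
  signed_perm s eps = mx_entrywise s (fun a _ t => (-1) ^+ eps a * t).
Proof. by apply/funext => x; apply/matrixP => a b; rewrite !mxE (ord1 b). Qed.

Lemma enorm_signed_perm s eps x : enorm (signed_perm s eps x) = enorm x.
Proof.
congr Num.sqrt; rewrite [RHS](reindex_perm s)/=.
by apply: eq_bigr => a _; rewrite mxE exprMn sqrr_sign mul1r.
Qed.

Lemma normalize_signed_perm s eps x :
  normalize (signed_perm s eps x) = signed_perm s eps (normalize x).
Proof.
by apply/matrixP => a b; rewrite !mxE enorm_signed_perm mulrCA.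
Qed.

Lemma sphere_cone_signed_perm s eps :
  signed_perm s eps @^-1` sphere_cone = sphere_cone.
Proof.
by apply/seteqP; split => x; rewrite /sphere_cone /unit_sphere /unit_ball/=
  normalize_signed_perm !enorm_signed_perm.
Qed.

Lemma Rintegral_signed_perm s eps (f : V -> R) : measurable_fun setT f ->
  \int[mu]_(x in sphere_cone) f (signed_perm s eps (normalize x)) =
  \int[mu]_(x in sphere_cone) f (normalize x).
Proof.
move=> mf; rewrite /Rintegral; congr fine; rewrite integral_mkcond [RHS]integral_mkcond.
pose G := (fun x => (f (normalize x))%:E) \_ sphere_cone.
have mG : measurable_fun setT G.
  apply/(measurable_restrictT _ mC)/measurable_funTS/measurable_EFinP.
  exact: (measurableT_comp mf (@measurable_normalize R n)).
have meps a (b : 'I_1) : measurable_fun setT (fun t : R => (-1) ^+ eps a * t).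
  exact: measurable_funM.
have msp : measurable_fun setT (signed_perm s eps).
  by rewrite signed_permE; exact: measurable_mx_entrywise.
rewrite -[RHS](integral_preserving (phi := signed_perm s eps))//; last first.
  move=> A mA; rewrite signed_permE; apply: mx_lebesgue_entrywise => // a b B mB.
  case: (eps a); last by congr lebesgue_measure; apply/seteqP; split=> t /=; rewrite mul1r.
  rewrite -[RHS]lebesgue_measureN//; congr lebesgue_measure.
  by apply/seteqP; split=> t /=; rewrite mulN1r.
apply: eq_integral => x _; rewrite /G /patch.
have -> : (signed_perm s eps x \in sphere_cone) = (x \in sphere_cone).
  by rewrite -[in RHS](sphere_cone_signed_perm s eps); apply/idP/idP; rewrite !inE.
by rewrite normalize_signed_perm.
Qed.

Lemma normalize_le1 x a : sphere_cone x -> `|normalize x a ord0| <= 1.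
Proof.
move=> [/= xS _]; rewrite -(@ler_pXn2r _ 2) ?nnegrE// real_normK ?num_real//.
rewrite expr1n -(expr1n _ 2) -[in leRHS]xS enorm_sum_sqr (bigD1 a)//= lerDl.
by apply: sumr_ge0 => b _; exact: sqr_ge0.
Qed.

Lemma integrable_sphere_cone (f : V -> R) (K : R) : measurable_fun setT f ->
  (forall x, sphere_cone x -> `|f (normalize x)| <= K) ->
  mu.-integrable sphere_cone (fun x => (f (normalize x))%:E).
Proof.
move=> mf fK; apply: (measurable_bounded_integrable (f := f \o @normalize R n)).
- exact: mC.
- exact: sphere_cone_lty.
- apply: measurable_funTS.
  exact: (measurableT_comp mf (@measurable_normalize R n)).
- exists K; split; first exact: num_real.
  by move=> M KM x /fK /le_trans; apply; exact: ltW.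
Qed.

Local Notation vol := (fine (mu sphere_cone)).

Lemma integrable_sphere_cone_moment a b : mu.-integrable sphere_cone
  (fun x => (normalize x a ord0 * normalize x b ord0)%:E).
Proof.
apply: (integrable_sphere_cone (f := fun e => e a ord0 * e b ord0) (K := 1)).
  by apply: measurable_funM; exact: measurable_mx_entry.
by move=> x xC; rewrite normrM -[leRHS]mulr1 ler_pM// normalize_le1.
Qed.

(** Flipping the sign of coordinate a makes a mixed moment equal to its opposite. Transpositions
    make the n pure moments equal, and they add up to [vol] because normalized vectors have norm
    1. *)
Lemma sphere_cone_moment a b :
  \int[mu]_(x in sphere_cone) (normalize x a ord0 * normalize x b ord0) =
  (a == b)%:R * (vol / n%:R).
Proof.
have mab (i j : 'I_n) : measurable_fun setT (fun e : V => e i ord0 * e j ord0).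
  by apply: measurable_funM; exact: measurable_mx_entry.
have iab := integrable_sphere_cone_moment.
have [->|ab] := eqVneq a b; last first.
  rewrite mul0r; set I := (LHS).
  have : I = - I; last by lra.
  rewrite /I -[LHS](Rintegral_signed_perm 1%g (fun i => i == a) (mab a b)).
  rewrite -mulN1r -RintegralZl; [|exact: mC|exact: iab].
  apply: eq_Rintegral => x _; rewrite !mxE !perm1 eqxx.
  by rewrite [b == a]eq_sym (negbTE ab) mul1r mulrA.
have all i : \int[mu]_(x in sphere_cone) (normalize x i ord0 * normalize x i ord0) =
             \int[mu]_(x in sphere_cone) (normalize x b ord0 * normalize x b ord0).
  rewrite -[RHS](Rintegral_signed_perm (tperm i b) (fun=> false) (mab b b)).
  by apply: eq_Rintegral => x _; rewrite !mxE tpermR !mul1r.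
rewrite mul1r; apply: (canRL (mulfK _)); first by rewrite pnatr_eq0 -lt0n.
have -> : vol = \int[mu]_(x in sphere_cone)
    (\sum_i normalize x i ord0 * normalize x i ord0).
  rewrite -[LHS]mul1r -Rintegral_cst; last exact: mC.
  apply: eq_Rintegral => x; rewrite inE => -[/= xS _].
  by rewrite -(expr1n _ 2) -xS enorm_sum_sqr; apply: eq_bigr => i _; rewrite expr2.
transitivity (\sum_(i < n) \int[mu]_(x in sphere_cone)
    (normalize x i ord0 * normalize x i ord0)).
  by under eq_bigr do rewrite all; rewrite sumr_const card_ord mulr_natr.
by rewrite Rintegral_sum//; exact: mC.
Qed.

(* By the symmetry x -> - x the exponential may be replaced by cosh. *)
Lemma sphere_cone_cosh (v : V) :
  vol * (1 + (\sum_a v a ord0 ^+ 2) / (2 * n%:R)) <=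
  \int[mu]_(x in sphere_cone) expR (\sum_a v a ord0 * normalize x a ord0).
Proof.
pose y (e : V) := \sum_a v a ord0 * e a ord0.
have my : measurable_fun setT y.
  by apply: measurable_sum => a; apply: measurable_funM => //; exact: measurable_mx_entry.
pose K := \sum_a `|v a ord0|.
have yK x : sphere_cone x -> `|y (normalize x)| <= K.
  move=> xC; apply: (le_trans (ler_norm_sum _ _ _)); apply: ler_sum => a _.
  by rewrite normrM ler_piMr// normalize_le1.
have ie : mu.-integrable sphere_cone (fun x => (expR (y (normalize x)))%:E).
  apply: (integrable_sphere_cone (f := expR \o y) (K := expR K)).
    exact: measurableT_comp.
  move=> x /yK xK; rewrite ger0_norm ?expR_ge0//= ler_expR.
  by rewrite (le_trans _ xK)// ler_norm.
have ieN : mu.-integrable sphere_cone (fun x => (expR (- y (normalize x)))%:E).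
  apply: (integrable_sphere_cone (f := fun e => expR (- y e)) (K := expR K)).
    by apply: measurableT_comp => //; exact: measurableT_comp.
  move=> x /yK xK; rewrite ger0_norm ?expR_ge0//= ler_expR.
  by rewrite (le_trans _ xK)// -normrN ler_norm.
have i1 : mu.-integrable sphere_cone (fun x => (2 : R)%:E).
  apply: (integrable_sphere_cone (f := fun=> 2) (K := `|2|)) => //.
have iy2 : mu.-integrable sphere_cone (fun x => (y (normalize x) ^+ 2)%:E).
  apply: (integrable_sphere_cone (f := fun e => y e ^+ 2) (K := K ^+ 2)).
    exact: measurable_funX.
  by move=> x /yK xK; rewrite normrX lerXn2r ?nnegrE// (le_trans _ xK).
(* Flipping every sign fixes the cone and turns y into - y. *)
have eE : \int[mu]_(x in sphere_cone) expR (- y (normalize x)) =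
          \int[mu]_(x in sphere_cone) expR (y (normalize x)).
  have me : measurable_fun setT (fun e => expR (y e)) by exact: measurableT_comp.
  rewrite -[RHS](Rintegral_signed_perm 1%g (fun=> true) me).
  apply: eq_Rintegral => x _; congr expR; rewrite /y -sumrN.
  by apply: eq_bigr => a _; rewrite [signed_perm _ _ _ a ord0]mxE perm1 mulN1r mulrN.
(* In the expanded square only the diagonal moments survive, whence the factor 1/n. *)
have y2E : \int[mu]_(x in sphere_cone) (y (normalize x) ^+ 2) =
           (\sum_a v a ord0 ^+ 2) * (vol / n%:R).
  pose N x a := normalize x a ord0.
  have iN0 := integrable_sphere_cone_moment.
  have iN a b : mu.-integrable sphere_cone
      (fun x => ((v a ord0 * v b ord0) * (N x a * N x b))%:E).
    exact: (integrableZl mC (v a ord0 * v b ord0) (iN0 a b)).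
  transitivity (\int[mu]_(x in sphere_cone)
    (\sum_a \sum_b ((v a ord0 * v b ord0) * (N x a * N x b)))).
    apply: eq_Rintegral => x _; rewrite expr2 /y mulr_suml; apply: eq_bigr => a _.
    by rewrite mulr_sumr; apply: eq_bigr => b _; rewrite mulrACA.
  rewrite Rintegral_sum; [|exact: mC|by move=> a; apply: integrable_Rsum => //; exact: mC].
  rewrite mulr_suml; apply: eq_bigr => a _.
  rewrite Rintegral_sum; [|exact: mC|exact: iN].
  rewrite (bigD1 a)//= big1 ?addr0 => [|b ba].
    rewrite RintegralZl; [|exact: mC|exact: iN0].
    by rewrite sphere_cone_moment eqxx mul1r expr2.
  rewrite RintegralZl; [|exact: mC|exact: iN0].
  by rewrite sphere_cone_moment eq_sym (negbTE ba) mul0r mulr0.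
have : \int[mu]_(x in sphere_cone) (2 + y (normalize x) ^+ 2) <=
       \int[mu]_(x in sphere_cone) (expR (y (normalize x)) + expR (- y (normalize x))).
  apply: le_Rintegral; first exact: mC.
  - exact: (integrableD mC i1 iy2).
  - exact: (integrableD mC ie ieN).
  - by move=> x _; exact: expRDexpRN_ge.
rewrite (RintegralD mC i1 iy2) (RintegralD mC ie ieN) eE y2E Rintegral_cst; last exact: mC.
have nR : n%:R != 0 :> R by rewrite pnatr_eq0 -lt0n.
set W := \sum_a v a ord0 ^+ 2; rewrite /y => h.
rewrite (_ : _ * (1 + _) = (2 * vol + W * (vol / n%:R)) / 2); last by field.
by rewrite ler_pdivrMr// mulr_natr mulr2n; exact: h.
Qed.

End sphere_integral.

(** * Derivatives along a line *)

Section directional_derivative.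
Context {R : realType}.

Lemma cvg_harmonic_bound (u : R^nat) (l C : R) :
  (forall k, `|u k - l| <= C * harmonic k) -> u @ \oo --> l.
Proof.
move=> uC; apply/cvgrPdist_le => e e0.
have C0 : 0 <= C.
  by have := uC 0; rewrite /= invr1 mulr1; apply: le_trans.
(* C may be 0, hence the division by C + 1. *)
have eC : 0 < e / (C + 1) by rewrite divr_gt0// ltr_wpDl.
apply: filterS (cvgr0_norm_le _ (@cvg_harmonic R) _ eC) => k.
rewrite ger0_norm ?harmonic_ge0// => hk; rewrite distrC (le_trans (uC k))//.
apply: (le_trans (ler_wpM2l C0 hk)).
by rewrite mulrCA ger_pMr// ler_pdivrMr ?mul1r ?lerDl// ltr_wpDl.
Qed.

Lemma is_deriveP (V W : normedModType R) (f : V -> W) (a v : V) (l : W) :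
  is_derive a v f l <-> h^-1 *: (f (h *: v + a) - f a) @[h --> 0^'] --> l.
Proof.
split=> [[df <-]//|fl].
by apply: DeriveDef; [apply/cvg_ex; exists l|exact/cvg_lim].
Qed.

(** In this form, differentiating under an integral amounts to integrating a pointwise Taylor
    remainder, with no passage to the limit inside the integral. *)
Lemma is_derive_quadratic_bound (f : R -> R) (l C : R) :
  (forall t, `|t| <= 1 -> `|f t - f 0 - t * l| <= C * t ^+ 2) ->
  is_derive (0 : R) (1 : R) f l.
Proof.
move=> fC.
have C0 : 0 <= C.
  by have := fC 1; rewrite normr1 lexx expr1n mulr1 => /(_ isT); apply: le_trans.
apply/is_deriveP/cvgrPdist_le => e e0.
near=> h.
have h0 : h != 0 by near: h; exact: nbhs_dnbhs_neq.
have [h1 hC] : `|h| <= 1 /\ C * `|h| <= e.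
  have : `|h| <= Num.min 1 (e / (C + 1)).
    near: h; apply: dnbhs0_le.
    by rewrite lt_min ltr01 divr_gt0// ltr_wpDl.
  rewrite le_min => /andP[-> he]; split => //.
  apply: (le_trans (ler_wpM2l C0 he)).
  by rewrite mulrCA ger_pMr// ler_pdivrMr ?mul1r ?lerDl// ltr_wpDl.
rewrite /GRing.scale/= mulr1 addr0.
rewrite (_ : l - _ = - (h^-1 * (f h - f 0 - h * l))); last by field.
rewrite normrN normrM normfV ler_pdivrMl ?normr_gt0//.
apply: (le_trans (fC h h1)); rewrite -real_normK ?num_real//.
by rewrite expr2 mulrA mulrC ler_wpM2l.
Unshelve. all: by end_near. Qed.

(** Difference quotients along the steps 1/(k+1), the sequential form that dominated convergence
    takes. *)
Lemma is_derive_harmonic (f : R -> R) (l : R) :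
  is_derive (0 : R) (1 : R) f l ->
  (f (harmonic k) - f 0) * k.+1%:R @[k --> \oo] --> l.
Proof.
move=> /is_deriveP df.
have h0 : (@harmonic R) @ \oo --> (0 : R)^'.
  move=> A [e /= e0 eA].
  apply: filterS (cvgr0_norm_lt _ (@cvg_harmonic R) _ e0) => k hk.
  by apply: eA; rewrite /= ?sub0r ?normrN// gt_eqF// harmonic_gt0.
have := cvg_comp _ _ h0 df; apply: cvg_trans; apply: near_eq_cvg; near=> k.
by rewrite /= /GRing.scale/= mulr1 addr0 invrK mulrC.
Unshelve. all: by end_near. Qed.

Section lines.
Context {m n : nat}.
Implicit Types (f : 'M[R]_(m, n) -> R) (X Z : 'M[R]_(m, n)).

Lemma is_derive_direction f X Z (l : R) :
  is_derive (0 : R) (1 : R) (fun t => f (X + t *: Z)) l -> is_derive X Z f l.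
Proof.
move=> /is_deriveP df; apply/is_deriveP; move: df; apply: cvg_trans.
apply: near_eq_cvg; near=> h.
by rewrite /= scale0r !addr0 [h *: (1 : R)]mulr1 [X + _]addrC.
Unshelve. all: by end_near. Qed.

(** Moving the base point to X + t Z reduces the derivative at t to one at 0, so derivatives are
    only ever computed at 0. *)
Lemma is_derive_line f (f' : 'M[R]_(m, n) -> R) Z X :
  (forall Y, is_derive (0 : R) (1 : R) (fun t => f (Y + t *: Z)) (f' Y)) ->
  forall t : R, is_derive t (1 : R) (fun t => f (X + t *: Z)) (f' (X + t *: Z)).
Proof.
move=> df t; have /is_deriveP := df (X + t *: Z).
move=> dX; apply/is_deriveP; move: dX; apply: cvg_trans.
apply: near_eq_cvg; near=> h.
by rewrite scale0r !addr0 [X in f (X)]addrAC -addrA -scalerDl addrC.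
Unshelve. all: by end_near. Qed.

Lemma is_derive_lipschitz f (f' : 'M[R]_(m, n) -> R) Z (L : R) :
  (forall Y, is_derive (0 : R) (1 : R) (fun t => f (Y + t *: Z)) (f' Y)) ->
  (forall Y, `|f' Y| <= L) ->
  forall X (t : R), 0 <= t -> `|f (X + t *: Z) - f X| <= L * t.
Proof.
move=> df f'L X t t0.
have [c _] := MVT_everywhere t0 (is_derive_line X df).
rewrite scale0r addr0 subr0 => ->; rewrite normrM (ger0_norm t0).
by rewrite ler_wpM2r.
Qed.

End lines.

End directional_derivative.

(** * Differentiation of Laplace transforms *)

Section exponential_moments.
Context d (T : measurableType d) (R : realType).
Variables (mu : {measure set T -> \bar R}) (W s : T -> R).
Hypotheses (W0 : forall x, 0 <= W x) (mW : measurable_fun setT W)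
  (ms : measurable_fun setT s).
Hypothesis intW : forall c, mu.-integrable setT (fun x => (expR (c * s x) * W x)%:E).

(** exp(c |s|) is at most exp(c s) + exp(- c s). *)
Lemma integrable_exp_norm (c : R) : 0 <= c ->
  mu.-integrable setT (fun x => (expR (c * `|s x|) * W x)%:E).
Proof.
move=> c0.
apply: (le_integrable measurableT _ _ (integrableD measurableT (intW c) (intW (- c)))).
  apply/measurable_EFinP; apply: measurable_funM => //.
  by apply: measurableT_comp => //; apply: measurable_funM => //; exact: measurableT_comp.
move=> x _ /=; rewrite lee_fin ger0_norm ?mulr_ge0 ?expR_ge0//.
apply: le_trans (ler_norm _); rewrite -mulrDl ler_wpM2r//.
have [s0|/ltW s0] := leP 0 (s x); first by rewrite ger0_norm// lerDl expR_ge0.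
by rewrite ler0_norm// mulrN mulNr lerDr expR_ge0.
Qed.

Lemma integrable_exp_dominated (c K : R) (f : T -> R) : 0 <= c ->
  measurable_fun setT f -> (forall x, `|f x| <= K * expR (c * `|s x|)) ->
  mu.-integrable setT (fun x => (f x * W x)%:E).
Proof.
move=> c0 mf fK.
apply: (le_integrable measurableT _ _
  (integrableZl measurableT K (integrable_exp_norm c0))).
  by apply/measurable_EFinP; exact: measurable_funM.
move=> x _ /=; rewrite lee_fin normrM (ger0_norm (W0 x)) mulrA.
apply: le_trans (ler_norm _); exact: ler_wpM2r.
Qed.

Lemma norm_le_expR (y : R) : `|y| <= expR `|y|.
Proof. by apply: le_trans (expR_ge1Dx `|y|); rewrite lerDr. Qed.

(** The factor [f] allows iteration: f = 1 gives the first derivative of the Laplace transform, and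
    f = s the second. *)
Lemma is_derive_laplace (c K : R) (f : T -> R) : 0 <= c ->
  measurable_fun setT f -> (forall x, `|f x| <= K * expR (c * `|s x|)) ->
  is_derive (0 : R) (1 : R)
    (fun t => \int[mu]_x (f x * expR (t * s x) * W x)) (\int[mu]_x (f x * s x * W x)).
Proof.
move=> c0 mf fK.
have ift t : mu.-integrable setT (fun x => (f x * expR (t * s x) * W x)%:E).
  apply: (@integrable_exp_dominated (c + `|t|) K (fun x => f x * expR (t * s x))).
  - by rewrite addr_ge0.
  - apply: measurable_funM => //; apply: measurableT_comp => //.
    exact: measurable_funM.
  - move=> x; rewrite normrM mulrDl expRD mulrA ler_pM//.
    by rewrite ger0_norm ?expR_ge0// ler_expR -normrM ler_norm.
have ifs : mu.-integrable setT (fun x => (f x * s x * W x)%:E).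
  apply: (@integrable_exp_dominated (c + 1) K (fun x => f x * s x)).
  - by rewrite addr_ge0.
  - exact: measurable_funM.
  - by move=> x; rewrite normrM mulrDl expRD mulrA mul1r ler_pM// norm_le_expR.
have c30 : 0 <= c + 3 by rewrite addr_ge0.
(* The exponent collects c from the growth of f, 2 from s^2 <= exp(2 |s|), and 1 from exp |t s| <=
   exp |s|. *)
pose C := \int[mu]_x (K * (expR ((c + 3) * `|s x|) * W x)).
apply: (@is_derive_quadratic_bound _ _ _ C) => t t1.
have f0E : \int[mu]_x (f x * expR (0 * s x) * W x) = \int[mu]_x (f x * W x).
  by apply: eq_Rintegral => x _; rewrite mul0r expR0 mulr1.
have iB := integrableB measurableT (ift t) (ift 0).
have itf := integrableZl measurableT t ifs.
have iD := integrableB measurableT iB itf.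
rewrite -(RintegralB measurableT (ift t) (ift 0)).
rewrite -(RintegralZl (mu := mu) t measurableT ifs) -(RintegralB measurableT iB itf).
apply: (le_trans (le_normr_Rintegral _ _)) => //.
rewrite mulrC -RintegralZl//=; last first.
  exact: (integrableZl measurableT K (integrable_exp_norm c30)).
apply: le_Rintegral => //.
- exact: (integrable_norm iD).
- exact: (integrableZl measurableT (t ^+ 2)
    (integrableZl measurableT K (integrable_exp_norm c30))).
move=> x _.
rewrite (_ : _ - _ = f x * (expR (t * s x) - 1 - t * s x) * W x); last first.
  by rewrite mul0r expR0; ring.
rewrite !normrM (ger0_norm (W0 x)) !mulrA ler_wpM2r//.
rewrite [leRHS](_ : _ = K * expR (c * `|s x|) * (t ^+ 2 * expR (3 * `|s x|))); last first.
  by rewrite mulrDl expRD; ring.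
apply: ler_pM => //.
apply: (le_trans (expRB1B_le_norm _)).
rewrite exprMn -mulrA ler_wpM2l ?sqr_ge0//.
rewrite (_ : 3 * `|s x| = `|s x| + `|s x| + `|s x|); last by ring.
rewrite !expRD ler_pM ?sqr_ge0 ?expR_ge0//.
  by rewrite -real_normK ?num_real// expr2 ler_pM// norm_le_expR.
by rewrite ler_expR normrM ler_piMl.
Qed.

End exponential_moments.

(** * The Stein identity *)

Section stein.
Context {R : realType} {m n : nat}.
Local Notation mu := (mx_lebesgue m n : {measure set 'M[R]_(m, n) -> \bar R}).
Variables (W s : 'M[R]_(m, n) -> R) (Z : 'M[R]_(m, n)) (g : R).
Hypotheses (W0 : forall X, 0 <= W X) (mW : measurable_fun setT W)
  (iW : mu.-integrable setT (fun X => (W X)%:E)) (ms : measurable_fun setT s)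
  (g0 : 0 <= g).
(* A Gaussian factor along Z: s is minus the logarithmic derivative of W. *)
Hypothesis WD : forall (t : R) X,
  W (X + t *: Z) = W X * expR (- (t * s X) - t ^+ 2 * g / 2).

(** By [WD], the weight tilted by exp(c s) is a constant multiple of W translated by - c Z, so it is
    integrable because W is. *)
Lemma integrable_tilt c : mu.-integrable setT (fun X => (expR (c * s X) * W X)%:E).
Proof.
have := integrableZl measurableT (expR (c ^+ 2 * g / 2))
  (integrable_mx_shift (- c *: Z) iW).
apply: eq_integrable => // X _ /=; rewrite WD -EFinM; congr EFin.
rewrite mulrCA mulrC -expRD; congr (expR _ * _); rewrite sqrrN; ring.
Qed.

Lemma stein (f f' : 'M[R]_(m, n) -> R) (K L : R) :
  measurable_fun setT f -> measurable_fun setT f' ->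
  (forall X, `|f X| <= K * (1 + `|s X|)) -> (forall X, `|f' X| <= L) ->
  (forall X, is_derive (0 : R) (1 : R) (fun t => f (X + t *: Z)) (f' X)) ->
  [/\ mu.-integrable setT (fun X => (f X * s X * W X)%:E),
      mu.-integrable setT (fun X => (f' X * W X)%:E) &
      \int[mu]_X (f X * s X * W X) = \int[mu]_X (f' X * W X)].
Proof.
move=> mf mf' fK f'L df.
have ex1 X : 1 + `|s X| <= expR (`|s X|) := expR_ge1Dx _.
have K0 : 0 <= K.
  have s0 : 0 < 1 + `|s 0| by rewrite ltr_pwDl.
  by rewrite -(pmulr_lge0 _ s0) (le_trans (normr_ge0 _) (fK 0)).
have ifW : mu.-integrable setT (fun X => (f X * W X)%:E).
  apply: (integrable_exp_dominated W0 mW ms integrable_tilt (c := 1) (K := K)) => // X.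
  by rewrite mul1r (le_trans (fK X))// ler_wpM2l.
have ifsW : mu.-integrable setT (fun X => (f X * s X * W X)%:E).
  apply: (integrable_exp_dominated W0 mW ms integrable_tilt (c := 2) (K := K)) => //.
    exact: measurable_funM.
  move=> X; rewrite normrM mulr_natl mulr2n expRD mulrA ler_pM ?norm_le_expR//.
  by rewrite (le_trans (fK X))// ler_wpM2l.
have if'W : mu.-integrable setT (fun X => (f' X * W X)%:E).
  apply: (integrable_exp_dominated W0 mW ms integrable_tilt (c := 0) (K := L)) => // X.
  by rewrite mul0r expR0 mulr1.
split=> //.
(* Difference quotients of f W along Z; each integrates to 0 by translation invariance. *)
pose D k X := (f (X + harmonic k *: Z) * W (X + harmonic k *: Z) - f X * W X) * k.+1%:R.
have mfW : measurable_fun setT (fun X => (f X * W X)%:E).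
  by apply/measurable_EFinP; exact: measurable_funM.
have iDk k : mu.-integrable setT (fun X =>
    (f (X + harmonic k *: Z) * W (X + harmonic k *: Z))%:E).
  exact: (integrable_mx_shift (harmonic k *: Z) ifW).
have D0 k : (\int[mu]_X (D k X)%:E = 0)%E.
  rewrite /D; under eq_integral do rewrite mulrC EFinM.
  rewrite integralZl//; last exact: (integrableB measurableT (iDk k) ifW).
  rewrite (integralB measurableT (iDk k) ifW).
  rewrite (integral_mx_shift (harmonic k *: Z) mfW) subee ?mule0//.
  exact: (integrable_fin_num measurableT ifW).
(* L pays for the increment of f, the other term for the increment of W. *)
pose C := L + K * (expR g * (1 + g)).
have h0 k : 0 < harmonic k :> R := harmonic_gt0 k.
have h1 k : harmonic k <= 1 :> R by rewrite /= invf_le1// ler1n.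
have hk k : harmonic k * k.+1%:R = 1 :> R by rewrite /= mulVf.
pose y k X : R := - (harmonic k * s X) - harmonic k ^+ 2 * g / 2.
have Wy k X : W (X + harmonic k *: Z) = W X * expR (y k X) by exact: WD.
have yb k X : `|y k X| <= (`|s X| + g) * harmonic k.
  rewrite /y -opprD normrN (le_trans (ler_normD _ _))// mulrDl.
  rewrite normrM (ger0_norm (ltW (h0 k))) mulrC lerD2l ger0_norm; last first.
    by rewrite mulr_ge0// mulr_ge0// sqr_ge0.
  rewrite mulrAC mulrC ler_wpM2l// ler_pdivrMr// expr2.
  by rewrite ler_wpM2l ?(ltW (h0 k))// (le_trans (h1 k))// ler1n.
have yb1 k X : `|y k X| <= `|s X| + g.
  by rewrite (le_trans (yb k X))// ler_piMr// addr_ge0.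
have ey k X : `|expR (y k X) - 1| <= (`|s X| + g) * expR (`|s X| + g) * harmonic k.
  by rewrite (le_trans (expRB1_le_norm _))// mulrAC ler_pM// ler_expR.
(* Discrete product rule: the increment of f against the translated weight, plus f against the
   increment of the weight. *)
have DE k X : D k X = ((f (X + harmonic k *: Z) - f X) * k.+1%:R) * (W X * expR (y k X))
    + f X * W X * ((expR (y k X) - 1) * k.+1%:R).
  by rewrite /D Wy; ring.
have bD k X : `|D k X| <= C * (expR (3 * `|s X|) * W X).
  rewrite DE (le_trans (ler_normD _ _))// /C [leRHS]mulrDl lerD//.
    rewrite normrM ler_pM//.
      have := is_derive_lipschitz df f'L X (ltW (h0 k)).
      rewrite normrM normr_nat => /(ler_wpM2r (ler0n R k.+1))/le_trans; apply.
      by rewrite -mulrA hk mulr1.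
    rewrite normrM mulrC (ger0_norm (W0 X)) ler_wpM2r// ger0_norm ?expR_ge0//.
    rewrite ler_expR (@le_trans _ _ `|s X|)//; last first.
      by rewrite ler_peMl// ler1n.
    apply: (@le_trans _ _ (- (harmonic k * s X))).
      by rewrite gerDl oppr_le0 mulr_ge0// mulr_ge0// sqr_ge0.
    rewrite (le_trans (ler_norm _))// normrN normrM ger0_norm ?(ltW (h0 k))//.
    by rewrite ler_piMl.
  rewrite -[f X * _ * _]mulrA normrM -[leRHS]mulrA.
  apply: (@le_trans _ _ (K * expR `|s X| * `|W X * ((expR (y k X) - 1) * k.+1%:R)|)).
    by rewrite ler_wpM2r// (le_trans (fK X))// ler_wpM2l.
  rewrite -mulrA ler_wpM2l// normrM (ger0_norm (W0 X)).
  have ek : `|(expR (y k X) - 1) * k.+1%:R| <= (`|s X| + g) * expR (`|s X| + g).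
    rewrite normrM normr_nat.
    apply: (le_trans (ler_wpM2r (ler0n R k.+1) (ey k X))).
    by rewrite -[leLHS]mulrA hk mulr1.
  have sg : `|s X| + g <= (1 + g) * expR `|s X|.
    apply: (@le_trans _ _ ((1 + g) * (1 + `|s X|))); last first.
      by rewrite ler_wpM2l// addr_ge0.
    by have := mulr_ge0 g0 (normr_ge0 (s X)); lra.
  (* Three factors exp |s| are spent: on the growth of f, on |s| + g <= (1 + g) exp |s|, and on
     exp(|s| + g). *)
  have E3 : expR (3 * `|s X|) = expR `|s X| * expR `|s X| * expR `|s X|.
    by rewrite -!expRD; congr expR; ring.
  rewrite E3.
  have := le_trans ek (ler_wpM2r (expR_ge0 _) sg); rewrite expRD.
  move=> /(ler_wpM2l (mulr_ge0 (expR_ge0 `|s X|) (W0 X))).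
  move=> h; rewrite [leLHS]mulrA (le_trans h)// le_eqVlt; apply/orP; left.
  by apply/eqP; rewrite [expR (_ + g)]expRD; ring.
have cD X : D k X @[k --> \oo] --> f' X * W X - f X * s X * W X.
  have c1 : (f (X + harmonic k *: Z) - f X) * k.+1%:R @[k --> \oo] --> f' X.
    by have := is_derive_harmonic (df X); rewrite scale0r addr0.
  have c2 : expR (y k X) @[k --> \oo] --> (1 : R).
    exact: cvg_harmonic_bound (ey ^~ X).
  have c3 : (expR (y k X) - 1) * k.+1%:R @[k --> \oo] --> - s X.
    apply: (@cvg_harmonic_bound _ _ _ ((`|s X| + g) ^+ 2 * expR (`|s X| + g) + g / 2)) => k.
    (* Since (k+1) y = - s - g / (2 (k+1)), the error is the Taylor remainder of exp plus a term of
       order 1/(k+1). *)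
    rewrite (_ : _ - _ = (expR (y k X) - 1 - y k X) * k.+1%:R - harmonic k * g / 2); last first.
      have yk : y k X * k.+1%:R = - s X - harmonic k * g / 2.
        transitivity (- s X * (harmonic k * k.+1%:R) -
            harmonic k * (harmonic k * k.+1%:R) * g / 2); last by rewrite hk !mulr1.
        by rewrite /y; field.
      by rewrite [in RHS]mulrBl yk; ring.
    rewrite (le_trans (ler_normB _ _))// [leRHS]mulrDl lerD//; last first.
      rewrite ger0_norm; first by rewrite mulrAC mulrC mulrA mulrAC.
      by rewrite mulr_ge0// mulr_ge0// ltW.
    rewrite normrM normr_nat.
    apply: (le_trans (ler_wpM2r (ler0n R k.+1) (expRB1B_le_norm (y k X)))).
    have -> : (`|s X| + g) ^+ 2 * expR (`|s X| + g) * harmonic k =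
       ((`|s X| + g) * harmonic k) ^+ 2 * expR (`|s X| + g) * k.+1%:R.
      rewrite exprMn; transitivity ((`|s X| + g) ^+ 2 * expR (`|s X| + g) *
        (harmonic k * (harmonic k * k.+1%:R))); first by rewrite hk mulr1.
      by ring.
    rewrite ler_wpM2r// ler_pM ?sqr_ge0 ?expR_ge0 ?ler_expR//.
    by rewrite -real_normK ?num_real// lerXn2r ?nnegrE// (le_trans _ (yb k X)).
  rewrite (_ : _ - _ = f' X * (W X * 1) + f X * W X * - s X); last by ring.
  under eq_fun do rewrite DE.
  apply: cvgD; first by apply: cvgM => //; apply: cvgM => //; exact: cvg_cst.
  by apply: cvgM => //; exact: cvg_cst.
have mD k : measurable_fun setT (fun X => (D k X)%:E).
  exact: (measurable_int _ (integrableZr measurableT k.+1%:R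
    (integrableB measurableT (iDk k) ifW))).
have mF : measurable_fun setT (fun X => (f' X * W X - f X * s X * W X)%:E).
  exact: measurable_int (integrableB measurableT if'W ifsW).
have DF : {ae mu, forall X, setT X -> (D k X)%:E @[k --> \oo] -->
    (f' X * W X - f X * s X * W X)%:E}.
  by apply: aeW => X _; apply: cvg_EFin; [exact: nearW|exact: cD].
have DB : {ae mu, forall X k, setT X ->
    (`|(D k X)%:E| <= (C * (expR (3 * `|s X|) * W X))%:E)%E}.
  by apply: aeW => X k _; rewrite /= lee_fin.
have iB : mu.-integrable setT (fun X => (C * (expR (3 * `|s X|) * W X))%:E).
  exact: (integrableZl measurableT C
    (integrable_exp_norm W0 mW ms integrable_tilt (ler0n R 3))).
have [_ _ lim0] := dominated_convergence measurableT mD mF DF iB DB.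
have E0 : (\int[mu]_X (f' X * W X - f X * s X * W X)%:E = 0)%E.
  rewrite -(cvg_lim (@ereal_hausdorff R) lim0) /=.
  by under eq_fun do rewrite D0; exact: lim_cst.
apply/esym/eqP; rewrite -subr_eq0 -(RintegralB measurableT if'W ifsW).
by rewrite /Rintegral E0.
Qed.

Hypothesis sD : forall (t : R) X, s (X + t *: Z) = s X + t * g.

(** Applying [stein] to f = 1 and f = s gives s mean 0 and second moment g, relative to the total
    mass. It serves as the posterior variance in the lower bound and as the variance of U_a in the
    upper one. *)
Lemma stein_quadratic (v b : R) :
  mu.-integrable setT (fun X => ((v - b * s X) ^+ 2 * W X)%:E) /\
  \int[mu]_X ((v - b * s X) ^+ 2 * W X) = (v ^+ 2 + b ^+ 2 * g) * \int[mu]_X W X.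
Proof.
have ds X : is_derive (0 : R) (1 : R) (fun t => s (X + t *: Z)) g.
  under eq_fun do rewrite sD.
  by apply: is_derive_eq; rewrite /GRing.scale/=; ring.
have [i1 _ E1] := @stein (cst 1) (cst 0) 1 0 (@measurable_cst _ _ _ _ _ _)
  (@measurable_cst _ _ _ _ _ _) (fun X => ltac:(by rewrite normr1 mul1r lerDl))
  (fun X => ltac:(by rewrite normr0)) (fun X => is_derive_cst _ _ _).
have [i2 _ E2] := @stein s (cst g) 1 g ms (@measurable_cst _ _ _ _ _ _)
  (fun X => ltac:(by rewrite mul1r lerDr)) (fun X => ltac:(by rewrite ger0_norm)) ds.
have {}i1 : mu.-integrable setT (fun X => (s X * W X)%:E).
  by apply: eq_integrable i1 => // X _; rewrite /= mul1r.
have {}E1 : \int[mu]_X (s X * W X) = 0.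
  transitivity (\int[mu]_X (cst 1 X * s X * W X)).
    by apply: eq_Rintegral => X _; rewrite /= mul1r.
  by rewrite E1; under eq_Rintegral do rewrite /= mul0r; rewrite Rintegral_cst// mul0r.
have {}E2 : \int[mu]_X (s X * s X * W X) = g * \int[mu]_X W X.
  by rewrite E2 RintegralZl.
have j0 := integrableZl measurableT (v ^+ 2) iW.
have j1 := integrableZl measurableT (2 * v * b) i1.
have j2 := integrableZl measurableT (b ^+ 2) i2.
have j01 := integrableB measurableT j0 j1.
have j := integrableD measurableT j01 j2.
have e X : (v - b * s X) ^+ 2 * W X =
    v ^+ 2 * W X - 2 * v * b * (s X * W X) + b ^+ 2 * (s X * s X * W X) by ring.
split; first by apply: eq_integrable j => // X _; rewrite e.
under eq_Rintegral do rewrite e.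
rewrite (RintegralD measurableT j01 j2) (RintegralB measurableT j0 j1).
rewrite !RintegralZl// E1 E2; ring.
Qed.

End stein.

(** * Gaussian densities and the lower bound *)

Section gaussian.
Context {R : realType}.

Lemma normal_pdf_center (m s x : R) : s != 0 ->
  normal_pdf m s x = normal_pdf 0 s (x - m).
Proof. by move=> s0; rewrite !normal_pdfE//= /normal_fun subr0. Qed.

Lemma normal_pdf_gt0 (m s x : R) : s != 0 -> 0 < normal_pdf m s x.
Proof.
by move=> s0; rewrite normal_pdfE//= mulr_gt0 ?expR_gt0// normal_peak_gt0.
Qed.

Lemma normal_pdfC (m s x : R) : s != 0 -> normal_pdf m s x = normal_pdf x s m.
Proof.
by move=> s0; rewrite !normal_pdfE//= /normal_fun -[in RHS]sqrrN opprB.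
Qed.

Lemma normal_pdfD (m s x u : R) : s != 0 ->
  normal_pdf m s (x + u) = normal_pdf m s x * expR (- (u * (x - m) + u ^+ 2 / 2) / s ^+ 2).
Proof.
move=> s0; rewrite !normal_pdfE//= -mulrA; congr (_ * _).
by rewrite /normal_fun -expRD; congr expR; field.
Qed.

Context {m n : nat}.
Implicit Types (M X Y Z : 'M[R]_(m, n)).

Definition frob X Y : R := \sum_a \sum_i X a i * Y a i.

(* [gauss_pdf 1] is convertible to [mxnormal_pdf]. *)
Definition gauss_pdf (s : R) M X : R :=
  \prod_(a < m) \prod_(i < n) normal_pdf (M a i) s (X a i).

Lemma frobDr X Y Z : frob X (Y + Z) = frob X Y + frob X Z.
Proof.
rewrite /frob -big_split; apply: eq_bigr => a _; rewrite -big_split.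
by apply: eq_bigr => i _; rewrite mxE mulrDr.
Qed.

Lemma frobZr X Y t : frob X (t *: Y) = t * frob X Y.
Proof.
rewrite /frob mulr_sumr; apply: eq_bigr => a _; rewrite mulr_sumr.
by apply: eq_bigr => i _; rewrite mxE mulrCA.
Qed.

Lemma frobC X Y : frob X Y = frob Y X.
Proof. by apply: eq_bigr => a _; apply: eq_bigr => i _; rewrite mulrC. Qed.

Lemma frobZl X Y t : frob (t *: X) Y = t * frob X Y.
Proof. by rewrite frobC frobZr frobC. Qed.

Lemma frobNr X Y : frob X (- Y) = - frob X Y.
Proof. by rewrite -scaleN1r frobZr mulN1r. Qed.

Lemma frobBr X Y Z : frob X (Y - Z) = frob X Y - frob X Z.
Proof. by rewrite frobDr frobNr. Qed.

Lemma measurable_frob X d (T : measurableType d) (f : T -> 'M[R]_(m, n)) :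
  measurable_fun setT f -> measurable_fun setT (fun x => frob X (f x)).
Proof.
move=> /measurable_fun_mxP mf; apply: measurable_sum => a.
by apply: measurable_sum => i; apply: measurable_funM.
Qed.

Lemma gauss_pdf_gt0 s M X : s != 0 -> 0 < gauss_pdf s M X.
Proof. by move=> s0; do 2 (apply: prodr_gt0 => ? _); exact: normal_pdf_gt0. Qed.

Lemma gauss_pdfC s M X : s != 0 -> gauss_pdf s M X = gauss_pdf s X M.
Proof.
by move=> s0; apply: eq_bigr => a _; apply: eq_bigr => i _; exact: normal_pdfC.
Qed.

Lemma gauss_pdfD s M X Z : s != 0 ->
  gauss_pdf s M (X + Z) =
  gauss_pdf s M X * expR (- (frob Z (X - M) + frob Z Z / 2) / s ^+ 2).
Proof.
move=> s0; rewrite /gauss_pdf /frob.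
under eq_bigr do under eq_bigr do rewrite mxE normal_pdfD//.
under eq_bigr do rewrite big_split/= -expR_sum.
rewrite big_split/= -expR_sum; congr (_ * expR _).
rewrite mulr_suml -big_split/= -sumrN mulr_suml; apply: eq_bigr => a _.
rewrite mulr_suml -big_split/= -sumrN mulr_suml; apply: eq_bigr => i _.
by rewrite !mxE expr2.
Qed.

Lemma gauss_pdf_shift s M X Z : s != 0 -> gauss_pdf s (M - Z) X = gauss_pdf s M (X + Z).
Proof.
move=> s0; apply: eq_bigr => a _; apply: eq_bigr => i _.
by rewrite normal_pdf_center// [RHS]normal_pdf_center// !mxE opprB addrA.
Qed.

Lemma measurable_gauss_pdf s d (T : measurableType d) (f g : T -> 'M[R]_(m, n)) :
  s != 0 -> measurable_fun setT f -> measurable_fun setT g ->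
  measurable_fun setT (fun x => gauss_pdf s (f x) (g x)).
Proof.
move=> s0 /measurable_fun_mxP mf /measurable_fun_mxP mg.
apply: measurable_prod => a _; apply: measurable_prod => i _.
under eq_fun do rewrite normal_pdf_center//.
apply: (measurableT_comp (measurable_normal_pdf 0 s)).
exact: measurable_funB.
Qed.

Lemma integral_gauss_pdf s M :
  (\int[mx_lebesgue m n]_X (gauss_pdf s M X)%:E = 1)%E.
Proof.
rewrite /gauss_pdf (integral_mx_prod (f := fun a i => normal_pdf (M a i) s)).
- by rewrite big1// => a _; rewrite big1// => i _; rewrite integral_normal_pdf.
- by move=> a i; exact: measurable_normal_pdf.
- by move=> a i x; exact: normal_pdf_ge0.
Qed.

Lemma integrable_gauss_pdf s M : s != 0 ->
  (mx_lebesgue m n).-integrable setT (fun X => (gauss_pdf s M X)%:E).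
Proof.
move=> s0; apply/integrableP; split.
  by apply/measurable_EFinP; exact: measurable_gauss_pdf.
under eq_integral do rewrite gee0_abs ?lee_fin ?(ltW (gauss_pdf_gt0 _ _ s0))//.
by rewrite integral_gauss_pdf ltry.
Qed.

End gaussian.

(** * The directions e_a c^T, dual to the coordinates of Y c *)

Section column_directions.
Context {R : realType} {n p : nat}.
Implicit Types (M X Y : 'M[R]_(n, p)) (c : 'cV[R]_p) (e : 'cV[R]_n) (a : 'I_n).

Definition sqnorm c : R := \sum_i c i ord0 ^+ 2.

Lemma sqnorm_ge0 c : 0 <= sqnorm c.
Proof. by apply: sumr_ge0 => i _; exact: sqr_ge0. Qed.

Definition dir (c : 'cV[R]_p) a : 'M[R]_(n, p) := delta_mx a ord0 *m c^T.

Lemma frob_outer e c Y : frob (e *m c^T) Y = \sum_a e a ord0 * (Y *m c) a ord0.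
Proof.
apply: eq_bigr => a _; rewrite mxE mulr_sumr; apply: eq_bigr => i _.
by rewrite !mxE big_ord1 !mxE -mulrA [c _ _ * _]mulrC.
Qed.

Lemma frob_outer_sqr e c :
  frob (e *m c^T) (e *m c^T) = (\sum_a e a ord0 ^+ 2) * sqnorm c.
Proof.
rewrite frob_outer mulr_suml; apply: eq_bigr => a _.
rewrite -mulmxA mxE big_ord1 mulrA -expr2; congr (_ * _).
by rewrite mxE; apply: eq_bigr => i _; rewrite mxE expr2.
Qed.

Lemma frob_dir c a Y : frob (dir c a) Y = (Y *m c) a ord0.
Proof.
rewrite frob_outer (bigD1 a)//= mxE !eqxx mul1r big1 ?addr0// => b ba.
by rewrite mxE (negbTE ba) mul0r.
Qed.

Lemma frob_dir_sqr c a : frob (dir c a) (dir c a) = sqnorm c.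
Proof.
rewrite frob_outer_sqr (bigD1 a)//= mxE !eqxx expr1n big1 ?addr0 ?mul1r// => b ba.
by rewrite mxE (negbTE ba) expr0n.
Qed.

Lemma quad_formE M N c :
  quad_form (quad_loss M N) c = \sum_a ((N *m c) a ord0 - (M *m c) a ord0) ^+ 2.
Proof.
rewrite /quad_form /quad_loss mulmxA -trmx_mul -mulmxA mxE.
by apply: eq_bigr => a _; rewrite [_^T _ _]mxE -expr2 mulmxBl; congr (_ ^+ 2); rewrite !mxE.
Qed.

End column_directions.

(** * Bayes risks of Gaussian priors *)

Section minimax_lower_bound.
Context {R : realType} {n p : nat}.
Implicit Types (M X : 'M[R]_(n, p)) (c : 'cV[R]_p).
Local Notation mu := (mx_lebesgue n p : {measure set 'M[R]_(n, p) -> \bar R}).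

Lemma gauss_pdf_ub s M X : s != 0 -> gauss_pdf s M X <= normal_peak s ^+ p ^+ n.
Proof.
move=> s0; rewrite -[n in leRHS]card_ord -prodr_const; apply: ler_prod => a _.
apply/andP; split; first by apply: prodr_ge0 => i _; exact: normal_pdf_ge0.
rewrite -[p in leRHS]card_ord -prodr_const; apply: ler_prod => i _.
by rewrite normal_pdf_ge0 normal_pdf_ub.
Qed.

Lemma integrable_gauss_posterior (t : R) X : t != 0 ->
  mu.-integrable setT (fun M => (gauss_pdf 1 M X * gauss_pdf t 0 M)%:E).
Proof.
move=> t0; have n10 : (1 : R) != 0 by exact: oner_neq0.
apply: (le_integrable measurableT _ _ (integrableZl measurableT
  (normal_peak 1 ^+ p ^+ n) (integrable_gauss_pdf 0 t0))).
  apply/measurable_EFinP; apply: measurable_funM;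
  by apply: measurable_gauss_pdf => //; exact: measurable_id.
move=> M _ /=; rewrite lee_fin ger0_norm; last first.
  by rewrite mulr_ge0// ltW// gauss_pdf_gt0.
apply: le_trans (ler_norm _).
by rewrite ler_wpM2r ?gauss_pdf_ub// ltW// gauss_pdf_gt0.
Qed.

(** With b = 1 + t^-2, the posterior of (M c)_a has mean (X c)_a / b and variance |c|^2 / b, and the
    mean squared error of any guess is at least the variance. *)
Lemma posterior_quadratic (t : R) (N X : 'M[R]_(n, p)) c a : t != 0 ->
  let W M := gauss_pdf 1 M X * gauss_pdf t 0 M in
  mu.-integrable setT (fun M => (((N *m c) a ord0 - (M *m c) a ord0) ^+ 2 * W M)%:E) /\
  sqnorm c / (1 + t ^- 2) * \int[mu]_M W M <=
  \int[mu]_M (((N *m c) a ord0 - (M *m c) a ord0) ^+ 2 * W M).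
Proof.
move=> t0 W.
have b0 : 0 < 1 + t ^- 2 by rewrite ltr_wpDr// invr_ge0 sqr_ge0.
set b := 1 + t ^- 2 in b0 *.
(* Minus the logarithmic derivative of the posterior weight along [dir c a]. *)
pose s M := b * (M *m c) a ord0 - (X *m c) a ord0.
have mid : measurable_fun setT (fun M : 'M[R]_(n, p) => M) by exact: measurable_id.
have n10 : (1 : R) != 0 by exact: oner_neq0.
have W0 M : 0 <= W M by rewrite mulr_ge0// ltW// gauss_pdf_gt0.
have mW : measurable_fun setT W.
  by apply: measurable_funM; exact: measurable_gauss_pdf.
have iW := integrable_gauss_posterior X t0.
have ms : measurable_fun setT s.
  apply: measurable_funB => //; apply: measurable_funM => //.
  under eq_fun do rewrite -frob_dir; exact: measurable_frob.
have g0 : 0 <= b * sqnorm c by rewrite mulr_ge0 ?sqnorm_ge0// ltW.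
have WD (u : R) M : W (M + u *: dir c a) =
    W M * expR (- (u * s M) - u ^+ 2 * (b * sqnorm c) / 2).
  rewrite /W gauss_pdfC// gauss_pdfD// [gauss_pdf 1 X M]gauss_pdfC// gauss_pdfD//.
  rewrite mulrACA -expRD; congr (_ * expR _).
  rewrite subr0 !frobZl !frobZr !frobBr frob_dir_sqr !frob_dir /s /b.
  by field.
have sD (u : R) M : s (M + u *: dir c a) = s M + u * (b * sqnorm c).
  rewrite /s -!frob_dir frobDr frobZr frob_dir_sqr; ring.
have [i E] := stein_quadratic W0 mW iW ms g0 WD sD
  ((N *m c) a ord0 - (X *m c) a ord0 / b) (b^-1).
have e M : (N *m c) a ord0 - (X *m c) a ord0 / b - b^-1 * s M =
    (N *m c) a ord0 - (M *m c) a ord0.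
  by rewrite /s; field; rewrite gt_eqF.
split; first by apply: eq_integrable i => // M _; rewrite e.
under [leRHS]eq_Rintegral do rewrite -e.
rewrite E ler_wpM2r ?Rintegral_ge0//.
rewrite (_ : b^-1 ^+ 2 * _ = sqnorm c / b); last by field; rewrite gt_eqF.
by rewrite lerDr sqr_ge0.
Qed.

Lemma measurable_quad_loss d (S : measurableType d) (f g : S -> 'M[R]_(n, p)) c :
  measurable_fun setT f -> measurable_fun setT g ->
  measurable_fun setT (fun x => quad_form (quad_loss (f x) (g x)) c).
Proof.
move=> mf mg; under eq_fun do rewrite quad_formE.
apply: measurable_sum => a; apply: measurable_funX; apply: measurable_funB.
  by under eq_fun do rewrite -frob_dir; exact: measurable_frob.
by under eq_fun do rewrite -frob_dir; exact: measurable_frob.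
Qed.

Lemma quad_form_loss_ge0 M N c : 0 <= quad_form (quad_loss M N) c.
Proof. by rewrite quad_formE; apply: sumr_ge0 => a _; exact: sqr_ge0. Qed.

Lemma bayes_risk_ge (T : 'M[R]_(n, p) -> 'M[R]_(n, p)) (t : R) c :
  estimator T -> t != 0 ->
  ((n%:R * (sqnorm c / (1 + t ^- 2)))%:E <=
   \int[mu]_M (quad_risk T M c * (gauss_pdf t 0 M)%:E))%E.
Proof.
move=> mT t0.
have n10 : (1 : R) != 0 by exact: oner_neq0.
pose Q M X := quad_form (quad_loss M (T X)) c.
pose q M := gauss_pdf t 0 M.
have q0 M : 0 <= q M by rewrite ltW// gauss_pdf_gt0.
have f0 M X : 0 <= gauss_pdf 1 M X by rewrite ltW// gauss_pdf_gt0.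
have mid : measurable_fun setT (fun M : 'M[R]_(n, p) => M) by exact: measurable_id.
have mQ : measurable_fun setT (fun z : 'M[R]_(n, p) * 'M[R]_(n, p) =>
    (Q z.1 z.2 * gauss_pdf 1 z.1 z.2 * q z.1)%:E).
  apply/measurable_EFinP; apply: measurable_funM; last exact: measurable_gauss_pdf.
  apply: measurable_funM; last exact: measurable_gauss_pdf.
  by apply: measurable_quad_loss => //; exact: measurableT_comp.
have mf1 : measurable_fun setT (fun z : 'M[R]_(n, p) * 'M[R]_(n, p) =>
    (gauss_pdf 1 z.1 z.2 * q z.1)%:E).
  apply/measurable_EFinP; apply: measurable_funM; exact: measurable_gauss_pdf.
set k := n%:R * _.
have k0 : 0 <= k.
  rewrite mulr_ge0// divr_ge0 ?sqnorm_ge0// addr_ge0// invr_ge0 sqr_ge0//.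
(* The order of integration is exchanged because at fixed X the estimate [T X] is a constant guess
   for M. *)
have -> : (\int[mu]_M (quad_risk T M c * (gauss_pdf t 0 M)%:E) =
    \int[mu]_X \int[mu]_M (Q M X * gauss_pdf 1 M X * q M)%:E)%E.
  rewrite -(fubini_tonelli (fun z => (Q z.1 z.2 * gauss_pdf 1 z.1 z.2 * q z.1)%:E))//.
    apply: eq_integral => M _; rewrite /quad_risk /expect -ge0_integralZr//.
    - apply/measurable_EFinP; apply: measurable_funM; last exact: measurable_gauss_pdf.
      exact: measurable_quad_loss.
    - by move=> X _; rewrite lee_fin; apply: mulr_ge0; [exact: quad_form_loss_ge0|exact: f0].
    - by rewrite lee_fin; exact: q0.
  by move=> z; rewrite lee_fin mulr_ge0// mulr_ge0//; exact: quad_form_loss_ge0.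
have f1G : measurable_fun setT (fun X => (\int[mu]_M (gauss_pdf 1 M X * q M)%:E)%E).
  apply: (measurable_fun_fubini_tonelli_G (m1 := mx_lebesgue n p) _ mf1) => z.
  by rewrite lee_fin mulr_ge0.
have QG : measurable_fun setT
    (fun X => (\int[mu]_M (Q M X * gauss_pdf 1 M X * q M)%:E)%E).
  apply: (measurable_fun_fubini_tonelli_G (m1 := mx_lebesgue n p) _ mQ) => z.
  by rewrite lee_fin mulr_ge0// mulr_ge0//; exact: quad_form_loss_ge0.
(* The joint density of M and X has mass 1, so the constant can be spread over it and the inequality
   checked at each X. *)
have -> : k%:E = (\int[mu]_X (k%:E * \int[mu]_M (gauss_pdf 1 M X * q M)%:E))%E.
  rewrite ge0_integralZl//; last first.
    by move=> X _; apply: integral_ge0 => M _; rewrite lee_fin mulr_ge0.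
  rewrite -(fubini_tonelli (fun z => (gauss_pdf 1 z.1 z.2 * q z.1)%:E))//; last first.
    by move=> z; rewrite lee_fin mulr_ge0.
  rewrite -[LHS]mule1 -(integral_gauss_pdf t (0 : 'M[R]_(n, p))); congr (_ * _)%E.
  apply: eq_integral => M _ /=; under eq_integral do rewrite mulrC EFinM.
  rewrite ge0_integralZl//; first by rewrite integral_gauss_pdf mule1.
  - by apply/measurable_EFinP; exact: measurable_gauss_pdf.
  - by move=> X _; rewrite lee_fin.
  - by rewrite lee_fin.
apply: ge0_le_integral => //.
- move=> X _; apply: mule_ge0; first by rewrite lee_fin.
  by apply: integral_ge0 => M _; rewrite lee_fin mulr_ge0.
- exact: measurable_funeM.
move=> X _.
have iW := integrable_gauss_posterior X t0.
have h a := posterior_quadratic (T X) X c a t0.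
pose u a M := (((T X) *m c) a ord0 - (M *m c) a ord0) ^+ 2 * (gauss_pdf 1 M X * q M).
have QE M : Q M X * gauss_pdf 1 M X * q M = \sum_a u a M.
  by rewrite /Q quad_formE -mulrA mulr_suml.
have iu a : mu.-integrable setT (fun M => (u a M)%:E) by have [] := h a.
under [leRHS]eq_integral do rewrite QE.
rewrite -[leRHS]fineK; last first.
  by apply: (integrable_fin_num measurableT); exact: integrable_Rsum.
rewrite -[X in (_ * X)%E]fineK; last exact: (integrable_fin_num measurableT iW).
rewrite -EFinM lee_fin.
have -> : fine (\int[mu]_M (\sum_a u a M)%:E) = \sum_a \int[mu]_M (u a M).
  by rewrite -Rintegral_sum.
rewrite /k mulr_natl mulrnAl -[n in _ *+ n]card_ord -sumr_const.
by apply: ler_sum => a _; have [_] := h a.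
Qed.

Lemma quad_risk_ge0 (T : 'M[R]_(n, p) -> 'M[R]_(n, p)) M c : (0 <= quad_risk T M c)%E.
Proof.
apply: integral_ge0 => X _; rewrite lee_fin mulr_ge0 ?quad_form_loss_ge0//.
by rewrite ltW// (gauss_pdf_gt0 _ _ (oner_neq0 R)).
Qed.

Lemma measurable_quad_risk (T : 'M[R]_(n, p) -> 'M[R]_(n, p)) c : estimator T ->
  measurable_fun setT (fun M => quad_risk T M c).
Proof.
move=> mT; have n10 : (1 : R) != 0 by exact: oner_neq0.
apply: (measurable_fun_fubini_tonelli_F (m2 := mx_lebesgue n p) (fun z =>
  (quad_form (quad_loss z.1 (T z.2)) c * gauss_pdf 1 z.1 z.2)%:E)).
  apply/measurable_EFinP; apply: measurable_funM; last exact: measurable_gauss_pdf.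
  by apply: measurable_quad_loss => //; exact: measurableT_comp.
move=> z; rewrite lee_fin mulr_ge0 ?quad_form_loss_ge0//.
by rewrite ltW// gauss_pdf_gt0.
Qed.

Lemma sup_risk_ge (T : 'M[R]_(n, p) -> 'M[R]_(n, p)) c : estimator T ->
  ((n%:R * sqnorm c)%:E <= sup_risk T c)%E.
Proof.
move=> mT.
have S0 : (0 <= sup_risk T c)%E.
  apply: (le_trans (quad_risk_ge0 T 0 c)); apply: ereal_sup_ubound.
  by exists 0.
have St (t : R) : t != 0 ->
    ((n%:R * (sqnorm c / (1 + t ^- 2)))%:E <= sup_risk T c)%E.
  move=> t0; apply: (le_trans (bayes_risk_ge c mT t0)).
  have q0 M : (0 <= (gauss_pdf t 0 M)%:E)%E by rewrite lee_fin ltW// gauss_pdf_gt0.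
  have mq : measurable_fun setT (fun M : 'M[R]_(n, p) => (gauss_pdf t 0 M)%:E).
    apply/measurable_EFinP; apply: measurable_gauss_pdf => //; exact: measurable_id.
  (* The prior has mass 1, so the average of the risk is at most its supremum. *)
  rewrite -[leRHS]mule1 -(integral_gauss_pdf t (0 : 'M[R]_(n, p))) -ge0_integralZl//.
  apply: ge0_le_integral => //.
  - by move=> M _; rewrite mule_ge0// quad_risk_ge0.
  - by apply: emeasurable_funM => //; exact: measurable_quad_risk.
  - exact: measurable_funeM.
  move=> M _; apply: lee_wpmul2r => //; apply: ereal_sup_ubound.
  by exists M.
case: (sup_risk T c) S0 St => [r| |]// S0 St; last by rewrite leey.
rewrite lee_fin; apply/ler_addgt0Pr => e e0.
rewrite lee_fin in S0.
(* An explicit t replaces the limit: e t >= r and t >= 1 give r / t^2 <= e. *)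
pose t := 1 + r / e.
have t1 : 1 <= t by rewrite lerDl divr_ge0// ltW.
have t0 : t != 0 by rewrite gt_eqF// (lt_le_trans ltr01).
have := St _ t0; rewrite lee_fin mulrA ler_pdivrMr; last first.
  by rewrite ltr_wpDr// invr_ge0 sqr_ge0.
move/le_trans; apply; rewrite mulrDr mulr1 lerD2l.
rewrite ler_pdivrMr ?exprn_gt0 ?(lt_le_trans ltr01)//.
apply: (@le_trans _ _ (e * t)).
  by rewrite /t mulrDr mulr1 mulrCA divff ?gt_eqF// mulr1 lerDr ltW.
by apply: ler_wpM2l; [exact: ltW|rewrite expr2 ler_peMl// (le_trans ler01)].
Qed.

End minimax_lower_bound.

(** * Superharmonic priors *)

Section superharmonic_posterior.
Context {R : realType} {n p : nat}.
Hypothesis n0 : (0 < n)%N.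
Local Notation mu := (mx_lebesgue n p).
Local Notation nu := (mx_lebesgue n 1).
Variable pi : 'M[R]_(n, p) -> \bar R.
Hypotheses (pi0 : forall M, (0 <= pi M)%E) (mpi : measurable_fun setT pi).
Hypothesis sh : forall M rho, (sphere_mean pi M rho <= pi M)%E.

Local Notation vol := (fine (nu (@sphere_cone R n))).

Lemma sphere_vol_gt0 : 0 < vol.
Proof. by rewrite fine_gt0// sphere_cone_gt0// sphere_cone_lty. Qed.

Lemma sphere_areaE : @sphere_area R n = n%:R * vol.
Proof. by rewrite /sphere_area /sphere_measure fineM// ge0_fin_numE// sphere_cone_lty. Qed.

Lemma measurable_outer (rho : 'cV[R]_p) d (T : measurableType d)
    (f : T -> 'M[R]_(n, p)) (g : T -> 'cV[R]_n) :
  measurable_fun setT f -> measurable_fun setT g ->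
  measurable_fun setT (fun x => f x + g x *m rho^T).
Proof.
move=> /measurable_fun_mxP mf /measurable_fun_mxP mg; apply/measurable_fun_mxP => a i.
rewrite (_ : (fun x => _) = fun x => f x a i + g x a ord0 * rho i ord0).
  by apply: measurable_funD => //; exact: measurable_funM.
by apply/funext => x; rewrite !mxE big_ord1 !mxE.
Qed.

(** The n in the surface measure cancels against the area n * [vol]; the form without denominators
    can be multiplied by the kernel and integrated. *)
Lemma sphere_mean_cone M rho :
  (\int[nu]_(x in @sphere_cone R n) pi (M + normalize x *m rho^T)%R <=
   vol%:E * pi M)%E.
Proof.
have nR : n%:R != 0 :> R by rewrite pnatr_eq0 -lt0n.
have v0 := sphere_vol_gt0.
have := sh M rho; rewrite /sphere_mean ge0_integral_sphere//; last first.
  apply: measurableT_comp => //.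
  by apply: measurable_outer => //; exact: measurable_id.
rewrite sphere_areaE muleA -EFinM invfM mulrAC mulVf// mul1r => h.
rewrite -(lee_pmul2l (x := vol^-1%:E))//; last by rewrite lte_fin invr_gt0.
by rewrite muleA -EFinM mulVf ?gt_eqF// mul1e.
Qed.

Lemma integral_mul_indic d (T : measurableType d) (m : {measure set T -> \bar R})
    (D : set T) (f : T -> \bar R) :
  (\int[m]_(x in D) f x = \int[m]_x ((\1_D x)%:E * f x))%E.
Proof.
rewrite integral_mkcond; apply: eq_integral => x _.
by rewrite /patch indicE; case: ifP => _; rewrite ?mul1e ?mul0e.
Qed.

(** On the unit sphere the shifted kernel is its value at X, times exp(-r^2 |c|^2 / 2), times the
    exponential of a form linear in e; [sphere_cone_cosh] bounds the integral of the last factor. *)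
Lemma outer_gauss_lb (X M : 'M[R]_(n, p)) (c : 'cV[R]_p) (r : R) :
  ((vol * (expR (- (r ^+ 2 * sqnorm c / 2)) *
     (1 + r ^+ 2 * (\sum_a ((X - M) *m c) a ord0 ^+ 2) / (2 * n%:R)) *
     gauss_pdf 1 M X))%:E <=
   \int[nu]_(x in @sphere_cone R n)
     (gauss_pdf 1 M (X + normalize x *m (r *: c)^T))%:E)%E.
Proof.
have n10 : (1 : R) != 0 by exact: oner_neq0.
have nR : n%:R != 0 :> R by rewrite pnatr_eq0 -lt0n.
pose v : 'cV[R]_n := - r *: ((X - M) *m c).
pose k := gauss_pdf 1 M X * expR (- (r ^+ 2 * sqnorm c / 2)).
have k0 : 0 <= k by rewrite mulr_ge0 ?expR_ge0// ltW// gauss_pdf_gt0.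
have mC := @measurable_sphere_cone R n.
have pdfE x : @sphere_cone R n x ->
    gauss_pdf 1 M (X + normalize x *m (r *: c)^T) =
    k * expR (\sum_a v a ord0 * normalize x a ord0).
  move=> [/= xS _]; rewrite gauss_pdfD// frob_outer_sqr frob_outer /k -[RHS]mulrA -expRD.
  congr (_ * expR _); rewrite -enorm_sum_sqr xS !expr1n mul1r divr1 opprD.
  rewrite addrC; congr (_ + _).
    congr (- (_ / _)); rewrite /sqnorm mulr_sumr; apply: eq_bigr => i _.
    by rewrite mxE exprMn.
  rewrite -sumrN; apply: eq_bigr => a _.
  have sc k' (A : 'cV[R]_n) : (k' *: A) a ord0 = k' * A a ord0 by rewrite mxE.
  by rewrite -scalemxAr /v !sc; ring.
under eq_integral => x /[!inE] xC do rewrite pdfE//.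
have mv : measurable_fun setT (fun e : 'cV[R]_n => \sum_a v a ord0 * e a ord0).
  by apply: measurable_sum => a; apply: measurable_funM => //; exact: measurable_mx_entry.
have me : measurable_fun setT (fun e : 'cV[R]_n => expR (\sum_a v a ord0 * e a ord0)).
  exact: measurableT_comp.
have ie : nu.-integrable (@sphere_cone R n)
    (fun x => (expR (\sum_a v a ord0 * normalize x a ord0))%:E).
  apply: (integrable_sphere_cone me (K := expR (\sum_a `|v a ord0|))) => x xC.
  rewrite ger0_norm ?expR_ge0// ler_expR; apply: ler_sum => a _.
  by rewrite (le_trans (ler_norm _))// normrM ler_piMr// normalize_le1.
under eq_integral do rewrite EFinM.
rewrite (integralZl mC ie) -[X in (_ <= _ * X)%E]fineK; last first.
  exact: (integrable_fin_num mC ie).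
rewrite -EFinM lee_fin.
have := sphere_cone_cosh n0 v; move=> /(ler_wpM2l k0); apply: le_trans.
have -> : \sum_a v a ord0 ^+ 2 = r ^+ 2 * \sum_a ((X - M) *m c) a ord0 ^+ 2.
  by rewrite mulr_sumr; apply: eq_bigr => a _; rewrite mxE exprMn sqrrN.
by rewrite /k le_eqVlt; apply/orP; left; apply/eqP; ring.
Qed.

Lemma superharmonic_posterior_r (X : 'M[R]_(n, p)) (c : 'cV[R]_p) (r : R) :
  (\int[mu]_M ((expR (- (r ^+ 2 * sqnorm c / 2)) *
     (1 + r ^+ 2 * (\sum_a ((X - M) *m c) a ord0 ^+ 2) / (2 * n%:R)) *
     gauss_pdf 1 M X)%:E * pi M) <= marginal pi X)%E.
Proof.
have n10 : (1 : R) != 0 by exact: oner_neq0.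
have v0 := sphere_vol_gt0.
pose T (x : 'cV[R]_n) := normalize x *m (r *: c)^T.
have phi0 (M Y : 'M[R]_(n, p)) : 0 <= gauss_pdf 1 M Y.
  by rewrite ltW// gauss_pdf_gt0.
have mid : measurable_fun setT (fun M : 'M[R]_(n, p) => M) by exact: measurable_id.
have mC := @measurable_sphere_cone R n.
have mN : measurable_fun setT (fun x : 'cV[R]_n => normalize x).
  exact: measurable_normalize.
have mN2 : measurable_fun setT (fun z : 'M[R]_(n, p) * 'cV[R]_n => normalize z.2).
  exact: measurableT_comp.
have m12 : measurable_fun setT
    (fun z : 'M[R]_(n, p) * 'cV[R]_n => \1_(@sphere_cone R n) z.2 : R).
  by apply: measurableT_comp => //; exact: measurable_indic.
have mg1 : measurable_fun setT (fun z : 'M[R]_(n, p) * 'cV[R]_n =>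
    (gauss_pdf 1 z.1 X * \1_(@sphere_cone R n) z.2)%:E * pi (z.1 + T z.2)%R)%E.
  apply: emeasurable_funM.
    by apply/measurable_EFinP/measurable_funM => //; exact: measurable_gauss_pdf.
  by apply: measurableT_comp => //; exact: measurable_outer.
have mg2 : measurable_fun setT (fun z : 'M[R]_(n, p) * 'cV[R]_n =>
    (gauss_pdf 1 z.1 (X + T z.2) * \1_(@sphere_cone R n) z.2)%:E * pi z.1)%E.
  apply: emeasurable_funM; last exact: measurableT_comp.
  apply/measurable_EFinP/measurable_funM => //; apply: measurable_gauss_pdf => //.
  exact: measurable_outer.
have F1 M : ((gauss_pdf 1 M X)%:E *
      \int[nu]_(x in @sphere_cone R n) pi (M + T x)%R =
    \int[nu]_x ((gauss_pdf 1 M X * \1_(@sphere_cone R n) x)%:E * pi (M + T x)%R))%E.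
  rewrite integral_mul_indic -ge0_integralZl//.
  - by apply: eq_integral => x _; rewrite muleA -EFinM.
  - apply: emeasurable_funM; first by apply/measurable_EFinP; exact: measurable_indic.
    by apply: measurableT_comp => //; exact: measurable_outer.
  - by move=> x _; rewrite mule_ge0// lee_fin.
  - by rewrite lee_fin.
have F2 M : (pi M * \int[nu]_(x in @sphere_cone R n) (gauss_pdf 1 M (X + T x))%:E =
    \int[nu]_x ((gauss_pdf 1 M (X + T x) * \1_(@sphere_cone R n) x)%:E * pi M))%E.
  rewrite integral_mul_indic -ge0_integralZl//.
  - by apply: eq_integral => x _; rewrite EFinM muleC [((gauss_pdf _ _ _)%:E * _)%E]muleC.
  - apply: emeasurable_funM; first by apply/measurable_EFinP; exact: measurable_indic.
    apply/measurable_EFinP; apply: measurable_gauss_pdf => //.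
    exact: measurable_outer.
  - by move=> x _; rewrite mule_ge0// lee_fin.
have g10 z : (0 <= (gauss_pdf 1 z.1 X * \1_(@sphere_cone R n) z.2)%:E * pi (z.1 + T z.2)%R)%E.
  by rewrite mule_ge0// lee_fin mulr_ge0.
have g20 z : (0 <= (gauss_pdf 1 z.1 (X + T z.2) * \1_(@sphere_cone R n) z.2)%:E * pi z.1)%E.
  by rewrite mule_ge0// lee_fin mulr_ge0.
(* The average passes from the prior to the kernel: after Tonelli, translating M by [T x] undoes the
   displacement, as the kernel depends only on X - M. *)
have E1 : (\int[mu]_M ((gauss_pdf 1 M X)%:E *
     \int[nu]_(x in @sphere_cone R n) pi (M + T x)%R) =
   \int[mu]_M (pi M * \int[nu]_(x in @sphere_cone R n) (gauss_pdf 1 M (X + T x))%:E))%E.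
  under eq_integral do rewrite F1.
  under [RHS]eq_integral do rewrite F2.
  rewrite (fubini_tonelli _ mg1 g10) (fubini_tonelli _ mg2 g20).
  apply: eq_integral => x _ /=.
  rewrite -[RHS](integral_mx_shift (T x)); last first.
    apply: emeasurable_funM => //.
    by apply/measurable_EFinP/measurable_funM => //; exact: measurable_gauss_pdf.
  apply: eq_integral => M _; congr ((_ * _)%:E * _)%E.
  by rewrite -(gauss_pdf_shift _ _ _ n10) addrK.
have E2 : (\int[mu]_M ((gauss_pdf 1 M X)%:E *
     \int[nu]_(x in @sphere_cone R n) pi (M + T x)%R) <= vol%:E * marginal pi X)%E.
  rewrite -ge0_integralZl//; last 3 first.
  - by apply: emeasurable_funM => //; apply/measurable_EFinP; exact: measurable_gauss_pdf.
  - by move=> M _; rewrite mule_ge0// lee_fin; exact: phi0.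
  - by rewrite lee_fin ltW.
  apply: ge0_le_integral => //.
  - by move=> M _; rewrite mule_ge0 ?lee_fin// integral_ge0.
  - under eq_fun do rewrite F1.
    exact: (measurable_fun_fubini_tonelli_F (m2 := nu) _ mg1 g10).
  - apply: measurable_funeM.
    by apply: emeasurable_funM => //; apply/measurable_EFinP; exact: measurable_gauss_pdf.
  - move=> M _; rewrite [leRHS]muleCA; apply: lee_wpmul2l; first by rewrite lee_fin.
    exact: sphere_mean_cone.
pose A M := expR (- (r ^+ 2 * sqnorm c / 2)) *
  (1 + r ^+ 2 * (\sum_a ((X - M) *m c) a ord0 ^+ 2) / (2 * n%:R)) * gauss_pdf 1 M X.
have A0 M : 0 <= A M.
  rewrite !mulr_ge0 ?expR_ge0// addr_ge0// divr_ge0// mulr_ge0 ?sqr_ge0//.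
  by apply: sumr_ge0 => a _; exact: sqr_ge0.
have mA : measurable_fun setT (fun M => (A M)%:E * pi M)%E.
  apply: emeasurable_funM => //; apply/measurable_EFinP.
  apply: measurable_funM; last exact: measurable_gauss_pdf.
  apply: measurable_funM => //; apply: measurable_funD => //.
  apply: measurable_funM => //; apply: measurable_funM => //.
  apply: measurable_sum => a; apply: measurable_funX.
  under eq_fun do rewrite -frob_dir frobBr.
  by apply: measurable_funB => //; exact: measurable_frob.
rewrite -(lee_pmul2l (x := vol%:E))//.
apply: le_trans E2; rewrite E1 -ge0_integralZl//.
- apply: ge0_le_integral => //.
  + by move=> M _; rewrite !mule_ge0// lee_fin ?(ltW v0)// A0.
  + exact: measurable_funeM.
  + under eq_fun do rewrite F2.
    exact: (measurable_fun_fubini_tonelli_F (m2 := nu) _ mg2 g20).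
  move=> M _; rewrite muleA -EFinM muleC; apply: lee_wpmul2l => //.
  exact: outer_gauss_lb.
- by move=> M _; rewrite mule_ge0// lee_fin A0.
- by rewrite lee_fin ltW.
Qed.

End superharmonic_posterior.

(** * Posterior moments *)

(** The Tonelli measurability result covers nonnegative functions, so positive and negative parts
    are treated apart. *)
Lemma measurable_Rintegral_section d1 d2 (T1 : measurableType d1)
    (T2 : measurableType d2) (R : realType)
    (m2 : {sigma_finite_measure set T2 -> \bar R}) (f : T1 * T2 -> R) :
  measurable_fun setT f ->
  measurable_fun setT (fun x => \int[m2]_y f (x, y)).
Proof.
move=> /measurable_EFinP mf.
apply: (measurableT_comp (fine_measurable measurableT)).
pose fp := fun z => ((EFin \o f)^\+ z)%E; pose fn := fun z => ((EFin \o f)^\- z)%E.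
rewrite (_ : (fun x => _) = fun x => (\int[m2]_y fp (x, y) - \int[m2]_y fn (x, y))%E).
  apply: emeasurable_funB.
    by apply: (measurable_fun_fubini_tonelli_F (m2 := m2) fp) => [|z];
      [exact: measurable_funepos|exact: funepos_ge0].
  by apply: (measurable_fun_fubini_tonelli_F (m2 := m2) fn) => [|z];
    [exact: measurable_funeneg|exact: funeneg_ge0].
apply/funext => x; rewrite integralE /fp /fn.
by congr (_ - _)%E; apply: eq_integral => y _; rewrite ?funeposE ?funenegE.
Qed.

Section posterior.
Context {R : realType} {n p : nat}.
Local Notation mu := (mx_lebesgue n p).
Implicit Types (X M Z : 'M[R]_(n, p)).
Variable pi : 'M[R]_(n, p) -> \bar R.
Hypotheses (hpi : prior pi) (hfin : forall X, (marginal pi X < +oo)%E).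

Let n10 : (1 : R) != 0. Proof. exact: oner_neq0. Qed.
Let pi0 M : (0 <= pi M)%E. Proof. by case: hpi. Qed.
Let mpi : measurable_fun setT pi. Proof. by case: hpi. Qed.
Let mid : measurable_fun setT (fun M : 'M[R]_(n, p) => M).
Proof. exact: measurable_id. Qed.

Let mone : measurable_fun setT (fun _ : 'M[R]_(n, p) => 1 : R).
Proof. exact: measurable_cst. Qed.

(* [pi] is finite almost everywhere because its marginal is finite. *)
Definition post_weight X M : R := gauss_pdf 1 M X * fine (pi M).
Local Notation W := post_weight.

Definition post_mass X : R := \int[mu]_M W X M.
Definition post_lin Z X : R := \int[mu]_M (frob Z (M - X) * W X M).
Definition post_sqr Z X : R := \int[mu]_M (frob Z (M - X) ^+ 2 * W X M).

Lemma post_weight_ge0 X M : 0 <= W X M.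
Proof. by rewrite mulr_ge0 ?fine_ge0// ltW// gauss_pdf_gt0. Qed.

Lemma measurable_post_weight : measurable_fun setT
  (fun z : 'M[R]_(n, p) * 'M[R]_(n, p) => W z.1 z.2).
Proof.
apply: measurable_funM; first exact: measurable_gauss_pdf.
exact: (measurableT_comp (fine_measurable measurableT)
  (measurableT_comp mpi measurable_snd)).
Qed.

Lemma measurable_post_weightr X : measurable_fun setT (W X).
Proof.
apply: measurable_funM; first exact: measurable_gauss_pdf.
exact: (measurableT_comp (fine_measurable measurableT) mpi).
Qed.

Let mgpi X : measurable_fun setT (fun M => (gauss_pdf 1 M X)%:E * pi M)%E.
Proof.
by apply: emeasurable_funM => //; apply/measurable_EFinP; exact: measurable_gauss_pdf.
Qed.

Lemma prior_ae_fin : {ae mu, forall M, pi M = (fine (pi M))%:E}.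
Proof.
have i0 : mu.-integrable setT (fun M => (gauss_pdf 1 M 0)%:E * pi M)%E.
  apply/integrableP; split => //.
  under eq_integral => M _.
    rewrite gee0_abs; last by rewrite mule_ge0// lee_fin ltW// gauss_pdf_gt0.
    over.
  exact: hfin.
apply: filterS (integrable_ae measurableT i0) => M /(_ I).
have g0 := gauss_pdf_gt0 M 0 n10.
move: (pi0 M); case: (pi M) => [r| |]//.
by rewrite mulry gtr0_sg// mul1e.
Qed.

(** The bridge from the extended-valued integrals of the definitions to real integrals against
    [post_weight]. *)
Lemma integral_prior (h : 'M[R]_(n, p) -> R) X : measurable_fun setT h ->
  (\int[mu]_M ((h M * gauss_pdf 1 M X)%:E * pi M) = \int[mu]_M (h M * W X M)%:E)%E.
Proof.
move=> mh; apply: ae_eq_integral => //.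
- apply: emeasurable_funM => //; apply/measurable_EFinP/measurable_funM => //.
  exact: measurable_gauss_pdf.
- apply/measurable_EFinP/measurable_funM => //; exact: measurable_post_weightr.
apply: filterS prior_ae_fin => M piM _.
by rewrite [in LHS]piM -EFinM mulrA.
Qed.

Lemma integrable_post_weight X : mu.-integrable setT (fun M => (W X M)%:E).
Proof.
apply/integrableP; split.
  by apply/measurable_EFinP; exact: measurable_post_weightr.
rewrite (_ : (\int[mu]_M _)%E = marginal pi X)//.
transitivity (\int[mu]_M (1 * W X M)%:E)%E.
  by apply: eq_integral => M _; rewrite gee0_abs ?lee_fin ?post_weight_ge0// mul1r.
by rewrite -(integral_prior X mone); apply: eq_integral => M _; rewrite mul1r.
Qed.

Lemma marginal_post_mass X : marginal pi X = (post_mass X)%:E.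
Proof.
rewrite fineK; last exact: (integrable_fin_num measurableT (integrable_post_weight X)).
transitivity (\int[mu]_M ((1 * gauss_pdf 1 M X)%:E * pi M))%E.
  by apply: eq_integral => M _; rewrite mul1r.
by rewrite (integral_prior X mone); apply: eq_integral => M _; rewrite mul1r.
Qed.

(** The kernel is positive everywhere, so zero mass would force the prior to vanish almost
    everywhere. *)
Lemma post_mass_gt0 X : 0 < post_mass X.
Proof.
rewrite lt_neqAle Rintegral_ge0 ?andbT; last by move=> M _; exact: post_weight_ge0.
apply/eqP => m0; have [_ _] := hpi; apply.
have : (\int[mu]_M `|(gauss_pdf 1 M X)%:E * pi M| = 0)%E.
  transitivity (marginal pi X); last by rewrite marginal_post_mass -m0.
  apply: eq_integral => M _; rewrite gee0_abs// mule_ge0// lee_fin ltW//.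
  exact: gauss_pdf_gt0.
move=> /(ae_eq_integral_abs mu measurableT (mgpi X)); apply: filterS => M /(_ I).
move=> /eqP; rewrite mule_eq0 => /orP[|/eqP//].
by rewrite eqe gt_eqF// gauss_pdf_gt0.
Qed.

Section direction.
Variables (X Z : 'M[R]_(n, p)).
Let s M := frob Z (M - X).
Let g := frob Z Z.

(** Exponential tilting: moving X along Z makes the posterior moments, up to a Gaussian factor in t,
    Laplace transforms of s. *)
Lemma post_weightD (t : R) M :
  W (X + t *: Z) M = expR (- (t ^+ 2 * g / 2)) * (expR (t * s M) * W X M).
Proof.
rewrite /W gauss_pdfD// !frobZl !frobZr -/g expr1n divr1.
rewrite (_ : - _ = - (t ^+ 2 * g / 2) + t * s M); first by rewrite expRD; ring.
by rewrite /s !frobBr; ring.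
Qed.

Let ms : measurable_fun setT s.
Proof.
rewrite /s; under eq_fun do rewrite frobBr.
by apply: measurable_funB => //; exact: measurable_frob.
Qed.

(** Finiteness of the marginal at the displaced point X + k Z is exactly the exponential moment of
    order k at X. *)
Lemma integrable_post_tilt (k : R) :
  mu.-integrable setT (fun M => (expR (k * s M) * W X M)%:E).
Proof.
have := integrableZl measurableT (expR (k ^+ 2 * g / 2))
  (integrable_post_weight (X + k *: Z)).
apply: eq_integrable => // M _ /=.
rewrite post_weightD -EFinM (mulrA (expR (k ^+ 2 * g / 2))).
by rewrite -[X in (X * _)%:E]expRD subrr expR0 mul1r.
Qed.

Let W0 := post_weight_ge0 X.
Let mW := measurable_post_weightr X.

Let s1 (M : 'M[R]_(n, p)) : `|1 : R| <= 1 * expR (0 * `|s M|).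
Proof. by rewrite normr1 mul0r expR0 mulr1. Qed.

Let s2 M : `|s M| <= 1 * expR (1 * `|s M|).
Proof. by rewrite !mul1r norm_le_expR. Qed.

Lemma integrable_post_lin : mu.-integrable setT (fun M => (s M * W X M)%:E).
Proof. exact: (integrable_exp_dominated W0 mW ms integrable_post_tilt _ _ s2). Qed.

Lemma integrable_post_sqr : mu.-integrable setT (fun M => (s M ^+ 2 * W X M)%:E).
Proof.
apply: (integrable_exp_dominated W0 mW ms integrable_post_tilt (c := 2) (K := 1)) => //.
  exact: measurable_funX.
by move=> M; rewrite mul1r mulr_natl mulr2n expRD normrX expr2 ler_pM// norm_le_expR.
Qed.

Let laplace0 : is_derive (0 : R) (1 : R)
  (fun t => \int[mu]_M (expR (t * s M) * W X M)) (post_lin Z X).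
Proof.
have := is_derive_laplace W0 mW ms integrable_post_tilt (lexx 0)
  mone s1.
under eq_fun do under eq_Rintegral do rewrite /= mul1r.
by under eq_Rintegral do rewrite /= mul1r.
Qed.

Let laplace1 : is_derive (0 : R) (1 : R)
  (fun t => \int[mu]_M (s M * expR (t * s M) * W X M)) (post_sqr Z X).
Proof.
have := is_derive_laplace W0 mW ms integrable_post_tilt ler01 ms s2.
by under [X in is_derive _ _ _ X]eq_Rintegral do rewrite -expr2.
Qed.

Let is_derive_gauss :
  is_derive (0 : R) (1 : R) (fun t : R => expR (- (t ^+ 2 * g / 2))) 0.
Proof.
apply: is_derive_eq; rewrite /GRing.scale/=; ring.
Qed.

Let post_massE (t : R) : post_mass (X + t *: Z) =
  expR (- (t ^+ 2 * g / 2)) * \int[mu]_M (expR (t * s M) * W X M).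
Proof.
rewrite -(RintegralZl _ measurableT (integrable_post_tilt t)).
by apply: eq_Rintegral => M _; rewrite post_weightD.
Qed.

Lemma is_derive_post_mass : is_derive (0 : R) (1 : R)
  (fun t => post_mass (X + t *: Z)) (post_lin Z X).
Proof.
under eq_fun do rewrite post_massE.
apply: (is_derive_eq (is_deriveM is_derive_gauss laplace0)).
by rewrite expr0n/= !mul0r oppr0 expR0 scale1r scaler0 addr0.
Qed.

Lemma is_derive_post_lin : is_derive (0 : R) (1 : R)
  (fun t => post_lin Z (X + t *: Z)) (post_sqr Z X - g * post_mass X).
Proof.
pose L1 t := \int[mu]_M (s M * expR (t * s M) * W X M).
pose L0 t := \int[mu]_M (expR (t * s M) * W X M).
have i1 t : mu.-integrable setT (fun M => (s M * expR (t * s M) * W X M)%:E).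
  apply: (integrable_exp_dominated W0 mW ms integrable_post_tilt
    (c := 1 + `|t|) (K := 1)) => //.
    by apply: measurable_funM => //; apply: measurableT_comp => //; exact: measurable_funM.
  move=> M; rewrite mul1r mulrDl mul1r expRD normrM ler_pM ?norm_le_expR//.
  by rewrite ger0_norm ?expR_ge0// ler_expR -normrM ler_norm.
(* The linear form is recentred at X + t Z and becomes s - t g; this is the origin of the term - g m
   in the second derivative of m. *)
have E t : post_lin Z (X + t *: Z) =
    expR (- (t ^+ 2 * g / 2)) * (L1 t - t * (g * L0 t)).
  rewrite /L1 /L0 -(RintegralZl g measurableT (integrable_post_tilt t)).
  have ig := integrableZl measurableT g (integrable_post_tilt t).
  rewrite -(RintegralZl t measurableT ig).
  have it := integrableZl measurableT t ig.
  rewrite -(RintegralB measurableT (i1 t) it).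
  rewrite -(RintegralZl _ measurableT (integrableB measurableT (i1 t) it)).
  apply: eq_Rintegral => M _; rewrite post_weightD.
  by rewrite opprD addrA frobBr frobZr -/g -/(s M); ring.
under eq_fun do rewrite E.
have dt : is_derive (0 : R) (1 : R) (fun t : R => t * (g * L0 t)) (g * L0 0).
  have d0 : is_derive (0 : R) (1 : R) (fun t => g * L0 t) (g * post_lin Z X).
    exact: (is_deriveZ g laplace0).
  apply: (is_derive_eq (is_deriveM (is_derive_id _ _) d0)).
  by rewrite scale0r add0r [_ *: _]mulr1.
apply: (is_derive_eq (is_deriveM is_derive_gauss (is_deriveB laplace1 dt))).
rewrite expr0n/= !mul0r oppr0 expR0 scale1r scaler0 addr0; congr (_ - _ * _).
by apply: eq_Rintegral => M _; rewrite mul0r expR0 mul1r.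
Qed.

(* Cauchy-Schwarz, as nonnegativity of the posterior variance. *)
Lemma post_lin_sqr : (post_lin Z X / post_mass X) ^+ 2 <= post_sqr Z X / post_mass X.
Proof.
have m0 := post_mass_gt0 X.
set l := post_lin Z X / post_mass X.
have i1 := integrableZl measurableT (2 * l) integrable_post_lin.
have i0 := integrableZl measurableT (l ^+ 2) (integrable_post_weight X).
have i21 := integrableB measurableT integrable_post_sqr i1.
have : 0 <= \int[mu]_M ((s M - l) ^+ 2 * W X M).
  by apply: Rintegral_ge0 => M _; rewrite mulr_ge0 ?sqr_ge0 ?post_weight_ge0.
rewrite (_ : \int[mu]_M _ = post_sqr Z X - 2 * l * post_lin Z X + l ^+ 2 * post_mass X).
  have -> : post_lin Z X = l * post_mass X by rewrite divfK// gt_eqF.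
  by rewrite ler_pdivlMr//; lra.
rewrite /post_lin /post_sqr /post_mass.
rewrite -(RintegralZl (2 * l) measurableT integrable_post_lin).
rewrite -(RintegralZl (l ^+ 2) measurableT (integrable_post_weight X)).
rewrite -(RintegralB measurableT integrable_post_sqr i1).
rewrite -(RintegralD measurableT i21 i0).
by apply: eq_Rintegral => M _; rewrite -/(s M); ring.
Qed.

End direction.
End posterior.

(** * The upper bound *)

Section generalized_bayes.
Context {R : realType} {n p : nat}.
Local Notation mu := (mx_lebesgue n p).
Implicit Types (X M Z : 'M[R]_(n, p)) (c : 'cV[R]_p).
Variable pi : 'M[R]_(n, p) -> \bar R.
Hypotheses (hpi : prior pi) (hfin : forall X, (marginal pi X < +oo)%E).

Let n10 : (1 : R) != 0. Proof. exact: oner_neq0. Qed.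
Let mid : measurable_fun setT (fun M : 'M[R]_(n, p) => M).
Proof. exact: measurable_id. Qed.

Local Notation W := (post_weight pi).
Local Notation m := (post_mass pi).
Local Notation b := (post_lin pi).
Local Notation V := (post_sqr pi).

(* The derivative of log m along Z, and below its own derivative along Z. *)
Definition score Z X : R := b Z X / m X.
Definition dscore Z X : R := V Z X / m X - frob Z Z - score Z X ^+ 2.

Let m_gt0 := post_mass_gt0 hpi hfin.

Lemma is_derive_score Z X :
  is_derive (0 : R) (1 : R) (fun t => score Z (X + t *: Z)) (dscore Z X).
Proof.
have m0 : m (X + (0 : R) *: Z) != 0 by rewrite gt_eqF.
have dm := is_derive_post_mass hpi hfin X Z.
have db := is_derive_post_lin hpi hfin X Z.
apply: (is_derive_eq (is_deriveM db (is_deriveV m0 dm))).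
move: m0; rewrite scale0r addr0 /GRing.scale/= /dscore /score => m0.
by field.
Qed.

Lemma log_marginalE X : log_marginal pi X = ln (m X).
Proof. by rewrite /log_marginal (marginal_post_mass hpi hfin). Qed.

Lemma is_derive_log_marginal Z X : is_derive X Z (log_marginal pi) (score Z X).
Proof.
apply: is_derive_direction; under eq_fun do rewrite log_marginalE.
have dm := is_derive_post_mass hpi hfin X Z.
have m0 : 0 < m (X + (0 : R) *: Z) by [].
have := is_derive1_comp (is_derive1_ln m0) dm.
by rewrite scale0r addr0 mulrC.
Qed.

Lemma frob_delta a i (Y : 'M[R]_(n, p)) : frob (delta_mx a i) Y = Y a i.
Proof.
rewrite /frob (bigD1 a)//= (bigD1 i)//= mxE !eqxx mul1r big1 ?addr0 => [|j ji].
  rewrite big1 ?addr0// => d da; rewrite big1// => j _.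
  by rewrite mxE (negbTE da) mul0r.
by rewrite mxE (negbTE ji) andbF mul0r.
Qed.

(** Tweedie's formula: split M = X + (M - X) under the posterior; the second part is the score. *)
Lemma gen_bayesE X a i : gen_bayes pi X a i = X a i + score (delta_mx a i) X.
Proof.
rewrite mxE (marginal_post_mass hpi hfin)/=.
have mai : measurable_fun setT (fun M : 'M[R]_(n, p) => M a i).
  exact: measurable_mx_entry.
have -> : fine (\int[mu]_M ((M a i * mxnormal_pdf M X)%:E * pi M)) =
    \int[mu]_M (M a i * W X M).
  by congr fine; exact: (integral_prior hpi hfin X mai).
have il := integrable_post_lin hpi hfin X (delta_mx a i).
have i0 := integrableZl measurableT (X a i) (integrable_post_weight hpi hfin X).
have -> : \int[mu]_M (M a i * W X M) = b (delta_mx a i) X + X a i * m X.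
  rewrite -(RintegralZl _ measurableT (integrable_post_weight hpi hfin X)).
  rewrite -(RintegralD measurableT il i0); apply: eq_Rintegral => M _.
  by rewrite frob_delta !mxE; ring.
by rewrite /score; field; rewrite gt_eqF.
Qed.

Lemma score_dir c a X : score (dir c a) X = \sum_i c i ord0 * score (delta_mx a i) X.
Proof.
rewrite /score; under [RHS]eq_bigr do rewrite mulrA.
rewrite -mulr_suml; congr (_ / _).
have il i := integrable_post_lin hpi hfin X (delta_mx a i).
under eq_bigr do rewrite -(RintegralZl _ measurableT (il _)).
rewrite -Rintegral_sum// => [|i]; last exact: (integrableZl measurableT _ (il i)).
apply: eq_Rintegral => M _; rewrite frob_dir mxE mulr_suml.
by apply: eq_bigr => i _; rewrite frob_delta; ring.
Qed.

Lemma gen_bayes_mul X c a :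
  (gen_bayes pi X *m c) a ord0 = (X *m c) a ord0 + score (dir c a) X.
Proof.
rewrite score_dir !mxE -big_split; apply: eq_bigr => i _ /=.
by rewrite gen_bayesE mulrDl [_ * c i ord0]mulrC addrC [_ * c i _]mulrC addrC.
Qed.

Let mW := measurable_post_weight hpi.
Let ms Z : measurable_fun setT (fun z : 'M[R]_(n, p) * 'M[R]_(n, p) => frob Z (z.2 - z.1)).
Proof.
by under eq_fun do rewrite frobBr; apply: measurable_funB => //; exact: measurable_frob.
Qed.

Lemma measurable_post_mass : measurable_fun setT m.
Proof. exact: (measurable_Rintegral_section mu mW). Qed.

Lemma measurable_post_lin Z : measurable_fun setT (b Z).
Proof. exact: (measurable_Rintegral_section mu (measurable_funM (ms Z) mW)). Qed.

Lemma measurable_post_sqr Z : measurable_fun setT (V Z).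
Proof.
exact: (measurable_Rintegral_section mu (measurable_funM (measurable_funX 2 (ms Z)) mW)).
Qed.

Let measurable_div (f g : 'M[R]_(n, p) -> R) : measurable_fun setT f ->
  measurable_fun setT g -> (forall X, 0 < g X) -> measurable_fun setT (fun X => f X / g X).
Proof.
move=> mf mg g0; apply: measurable_funM => //.
rewrite (_ : (fun X => _) = fun X => g X `^ (-1)).
  exact: (measurableT_comp (@measurable_powR R (-1)) mg).
by apply/funext => X; rewrite powR_inv1// ltW.
Qed.

Lemma measurable_score Z : measurable_fun setT (score Z).
Proof.
by apply: measurable_div => //; [exact: measurable_post_lin|exact: measurable_post_mass].
Qed.

Lemma measurable_dscore Z : measurable_fun setT (dscore Z).
Proof.
apply: measurable_funB; last by apply: measurable_funX; exact: measurable_score.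
apply: measurable_funB => //; apply: measurable_div => //.
  exact: measurable_post_sqr.
exact: measurable_post_mass.
Qed.

Lemma estimator_gen_bayes : estimator (gen_bayes pi).
Proof.
apply/measurable_fun_mxP => a i; under eq_fun do rewrite gen_bayesE.
apply: measurable_funD; last exact: measurable_score.
exact: measurable_mx_entry.
Qed.

Section superharmonic.
Hypothesis n0 : (0 < n)%N.
Hypothesis sh : forall M rho, (sphere_mean pi M rho <= pi M)%E.

Let q_ge0 c : 0 <= n%:R * sqnorm c.
Proof. by rewrite mulr_ge0// sqnorm_ge0. Qed.

Lemma post_sqr_sum X c : \sum_a V (dir c a) X <= n%:R * sqnorm c * m X.
Proof.
have [pi0 mpi _] := hpi.
have nR : n%:R != 0 :> R by rewrite pnatr_eq0 -lt0n.
set A := \sum_a _.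
have A0 : 0 <= A.
  apply: sumr_ge0 => a _; apply: Rintegral_ge0 => M _.
  by rewrite mulr_ge0 ?sqr_ge0// post_weight_ge0.
(* The radius-r inequality with both integrals over M evaluated through posterior moments. *)
have main (r : R) : expR (- (r ^+ 2 * sqnorm c / 2)) * (m X + r ^+ 2 / (2 * n%:R) * A) <= m X.
  pose k := expR (- (r ^+ 2 * sqnorm c / 2)).
  pose h M := k * (1 + r ^+ 2 * (\sum_a ((X - M) *m c) a ord0 ^+ 2) / (2 * n%:R)).
  have mh : measurable_fun setT h.
    apply: measurable_funM => //; apply: measurable_funD => //.
    apply: measurable_funM => //; apply: measurable_funM => //.
    apply: measurable_sum => a; apply: measurable_funX.
    under eq_fun do rewrite -frob_dir frobBr.
    by apply: measurable_funB => //; exact: measurable_frob.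
  have := superharmonic_posterior_r n0 pi0 mpi sh X c r.
  rewrite (integral_prior hpi hfin X mh) (marginal_post_mass hpi hfin).
  have i0 := integrable_post_weight hpi hfin X.
  have i2 a := integrable_post_sqr hpi hfin X (dir c a).
  have iS : mu.-integrable setT
      (fun M => (\sum_a frob (dir c a) (M - X) ^+ 2 * W X M)%:E).
    exact: integrable_Rsum.
  have iS' := integrableZl measurableT (r ^+ 2 / (2 * n%:R)) iS.
  have iD := integrableD measurableT i0 iS'.
  have hE M : h M * W X M =
      k * (W X M + r ^+ 2 / (2 * n%:R) * \sum_a frob (dir c a) (M - X) ^+ 2 * W X M).
    rewrite /h -mulr_suml.
    have -> : \sum_a frob (dir c a) (M - X) ^+ 2 = \sum_a ((X - M) *m c) a ord0 ^+ 2.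
      apply: eq_bigr => a _; rewrite -frob_dir !frobBr -[RHS]sqrrN; congr (_ ^+ 2).
      by rewrite opprB.
    by field.
  under eq_integral do rewrite hE.
  rewrite -[X in (X <= _)%E]fineK; last first.
    exact: (integrable_fin_num measurableT (integrableZl measurableT k iD)).
  rewrite lee_fin; apply: le_trans; rewrite le_eqVlt; apply/orP; left; apply/eqP.
  transitivity (\int[mu]_M (k * (W X M + r ^+ 2 / (2 * n%:R) *
    \sum_a frob (dir c a) (M - X) ^+ 2 * W X M))) => //.
  rewrite (RintegralZl k measurableT iD) (RintegralD measurableT i0 iS').
  by rewrite (RintegralZl _ measurableT iS) Rintegral_sum.
apply/ler_addgt0Pr => e e0.
have q0 := sqnorm_ge0 c.
have m0 := m_gt0 X.
pose d := 1 + sqnorm c * A.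
have d0 : 0 < d by rewrite ltr_pwDl// mulr_ge0.
(* A concrete small radius in place of a limit: r^2 = e / d yields x A <= e below, and the 1 in d
   keeps it positive. *)
pose r := Num.sqrt (e / d).
have r2 : r ^+ 2 = e / d by rewrite sqr_sqrtr// divr_ge0// ltW.
have r20 : 0 < r ^+ 2 by rewrite r2 divr_gt0.
have := main r.
set x := r ^+ 2 * sqnorm c / 2 => h.
have x0 : 0 <= x by rewrite divr_ge0// mulr_ge0// ltW.
pose y := r ^+ 2 / (2 * n%:R).
have nR0 : 0 < n%:R :> R by rewrite ltr0n.
have y0 : 0 < y by rewrite divr_gt0// mulr_gt0.
have xy : x = n%:R * sqnorm c * y by rewrite /x /y; field.
have xA : x * A <= e.
  rewrite /x r2 (_ : _ * A = e * (sqnorm c * A / 2 / d)); last by field; rewrite gt_eqF.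
  rewrite ger_pMr// ler_pdivrMr// mul1r /d.
  by have := mulr_ge0 q0 A0; lra.
have yA0 : 0 <= m X + y * A by rewrite addr_ge0 ?(ltW m0)// mulr_ge0// ltW.
(* With exp(- x) >= 1 - x this says y A <= x m + y x A; since x = n |c|^2 y, a factor y cancels. *)
have hA := le_trans (ler_wpM2r yA0 (expR_ge1Dx (- x))) h.
have yxA : y * (x * A) <= y * e by rewrite ler_wpM2l// ltW.
have xm : x * m X = y * (n%:R * sqnorm c * m X) by rewrite xy; ring.
by rewrite -(ler_pM2l y0) mulrDr; lra.
Qed.

Lemma gen_bayes_risk_le M0 c :
  (quad_risk (gen_bayes pi) M0 c <= (n%:R * sqnorm c)%:E)%E.
Proof.
pose q := sqnorm c.
have q0 : 0 <= q := sqnorm_ge0 c.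
pose Z a : 'M[R]_(n, p) := dir c a.
(* Each term of the bounded sum is nonnegative, so the bound holds for each a; it controls the score
   and its derivative uniformly in X. *)
have Vle a X : V (Z a) X / m X <= n%:R * q.
  rewrite ler_pdivrMr//; apply: le_trans (post_sqr_sum X c).
  rewrite (bigD1 a)//= lerDl; apply: sumr_ge0 => i _; apply: Rintegral_ge0 => M _.
  by rewrite mulr_ge0 ?sqr_ge0// post_weight_ge0.
have V0 a X : 0 <= V (Z a) X / m X.
  by rewrite (le_trans _ (post_lin_sqr hpi hfin X (Z a)))// sqr_ge0.
have G2 a X : score (Z a) X ^+ 2 <= n%:R * q.
  by rewrite (le_trans (post_lin_sqr hpi hfin X (Z a))).
have Gb a X : `|score (Z a) X| <= 1 + n%:R * q.
  have [h|/ltW h] := leP `|score (Z a) X| 1.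
    by rewrite (le_trans h)// lerDl q_ge0.
  rewrite (le_trans _ (le_trans (G2 a X) _))// ?lerDr//.
  by rewrite -real_normK ?num_real// expr2 ler_peMl.
have dGb a X : `|dscore (Z a) X| <= n%:R * q + q + n%:R * q.
  rewrite /dscore frob_dir_sqr -/q; have := G2 a X; have := sqr_ge0 (score (Z a) X).
  by have := Vle a X; have := V0 a X; rewrite ler_norml; lra.
pose w X := gauss_pdf 1 M0 X.
pose U a X := frob (Z a) (X - M0).
have w0 X : 0 <= w X by rewrite ltW// gauss_pdf_gt0.
have mw : measurable_fun setT w by exact: measurable_gauss_pdf.
have iw : mu.-integrable setT (fun X => (w X)%:E) by exact: integrable_gauss_pdf.
have mU a : measurable_fun setT (U a).
  rewrite /U; under eq_fun do rewrite frobBr.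
  by apply: measurable_funB => //; exact: measurable_frob.
have wD a (t : R) X : w (X + t *: Z a) = w X * expR (- (t * U a X) - t ^+ 2 * q / 2).
  rewrite /w gauss_pdfD// !frobZl !frobZr frob_dir_sqr expr1n divr1; congr (_ * expR _).
  by rewrite /U -/q; ring.
have UD a (t : R) X : U a (X + t *: Z a) = U a X + t * q.
  by rewrite /U !frobBr frobDr frobZr frob_dir_sqr -/q; ring.
have st a := stein w0 mw iw (mU a) q0 (wD a) (measurable_score (Z a))
  (measurable_dscore (Z a)) (K := 1 + n%:R * q) (L := n%:R * q + q + n%:R * q).
have Ew : \int[mu]_X w X = 1 by rewrite /Rintegral integral_gauss_pdf.
have iG a : mu.-integrable setT (fun X => (score (Z a) X ^+ 2 * w X)%:E).
  apply: (le_integrable measurableT _ _ (integrableZl measurableT (n%:R * q) iw)).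
    apply/measurable_EFinP/measurable_funM => //; apply: measurable_funX.
    exact: measurable_score.
  move=> X _ /=; rewrite lee_fin ger0_norm; last first.
    by apply: mulr_ge0; [exact: sqr_ge0|exact: w0].
  by apply: le_trans (ler_norm _); apply: ler_wpM2r; [exact: w0|exact: G2].
(* The square is expanded and [stein] turns its cross term 2 U G into 2 D G, one coordinate at a
   time. *)
have key : forall a, mu.-integrable setT
      (fun X => ((U a X + score (Z a) X) ^+ 2 * w X)%:E) /\
    mu.-integrable setT
      (fun X => ((2 * dscore (Z a) X + score (Z a) X ^+ 2) * w X)%:E) /\
    \int[mu]_X ((U a X + score (Z a) X) ^+ 2 * w X) =
    q + \int[mu]_X ((2 * dscore (Z a) X + score (Z a) X ^+ 2) * w X).
  move=> a; have [|//||i1 i2 E12] := st a.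
  - move=> X; rewrite (le_trans (Gb a X))// ler_peMr ?lerDl//.
    by rewrite addr_ge0// q_ge0.
  - exact: is_derive_score.
  (* With v = 0 and b = -1 the quadratic is U^2, of mean |c|^2. *)
  have [iU EU] := stein_quadratic w0 mw iw (mU a) q0 (wD a) (UD a) 0 (-1).
  have {}iU : mu.-integrable setT (fun X => (U a X ^+ 2 * w X)%:E).
    by apply: eq_integrable iU => // X _; rewrite mulN1r sub0r opprK.
  have {}EU : \int[mu]_X (U a X ^+ 2 * w X) = q.
    transitivity (\int[mu]_X ((0 - -1 * U a X) ^+ 2 * w X)).
      by apply: eq_Rintegral => X _; rewrite mulN1r sub0r opprK.
    by rewrite EU Ew expr0n/= sqrrN expr1n mul1r add0r mulr1.
  have j1 := integrableZl measurableT 2 i1.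
  have j2 := integrableZl measurableT 2 i2.
  have jU1 := integrableD measurableT iU j1.
  have jl := integrableD measurableT jU1 (iG a).
  have jr := integrableD measurableT j2 (iG a).
  have el X : (U a X + score (Z a) X) ^+ 2 * w X =
      U a X ^+ 2 * w X + 2 * (score (Z a) X * U a X * w X) + score (Z a) X ^+ 2 * w X.
    by ring.
  have er X : (2 * dscore (Z a) X + score (Z a) X ^+ 2) * w X =
      2 * (dscore (Z a) X * w X) + score (Z a) X ^+ 2 * w X by ring.
  split; first by apply: eq_integrable jl => // X _; rewrite el.
  split; first by apply: eq_integrable jr => // X _; rewrite er.
  under eq_Rintegral do rewrite el.
  under [in RHS]eq_Rintegral do rewrite er.
  rewrite (RintegralD measurableT jU1 (iG a)) (RintegralD measurableT iU j1).
  rewrite (RintegralD measurableT j2 (iG a)).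
  by rewrite (RintegralZl 2 measurableT i1) (RintegralZl 2 measurableT i2) E12 EU addrA.
have iL a := (key a).1.
have iR a := (key a).2.1.
have -> : quad_risk (gen_bayes pi) M0 c =
    (\int[mu]_X (\sum_a (U a X + score (Z a) X) ^+ 2 * w X)%:E)%E.
  apply: eq_integral => X _; congr EFin.
  rewrite quad_formE mulr_suml; apply: eq_bigr => a _; congr (_ ^+ 2 * _).
  by rewrite gen_bayes_mul /U frobBr !frob_dir; ring.
rewrite -[leLHS]fineK; last first.
  by apply: (integrable_fin_num measurableT); exact: integrable_Rsum.
rewrite lee_fin.
have -> : fine (\int[mu]_X (\sum_a (U a X + score (Z a) X) ^+ 2 * w X)%:E) =
    \sum_a \int[mu]_X ((U a X + score (Z a) X) ^+ 2 * w X).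
  by rewrite -Rintegral_sum.
under eq_bigr do rewrite (key _).2.2.
rewrite big_split/= sumr_const card_ord -[q *+ n]mulr_natl -/q gerDl -Rintegral_sum//.
rewrite -oppr_ge0 -mulN1r -RintegralZl//; last exact: integrable_Rsum.
apply: Rintegral_ge0 => X _; rewrite mulN1r -mulr_suml -mulNr mulr_ge0// oppr_ge0.
have := post_sqr_sum X c; rewrite -ler_pdivrMr// mulr_suml -/q => hV.
rewrite /dscore.
(* Here V / m - |c|^2 is the second derivative of m divided by m, so [post_sqr_sum] makes the first
   two terms together nonpositive. *)
have -> : \sum_a (2 * (V (Z a) X / m X - frob (Z a) (Z a) - score (Z a) X ^+ 2) +
    score (Z a) X ^+ 2) =
    2 * \sum_a (V (Z a) X / m X) - 2 * (n%:R * q) - \sum_a score (Z a) X ^+ 2.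
  have -> : 2 * (n%:R * q) = \sum_(a < n) (2 * q).
    by rewrite sumr_const card_ord -[RHS]mulr_natl; ring.
  rewrite mulr_sumr -!sumrB.
  by apply: eq_bigr => a _; rewrite frob_dir_sqr -/q; ring.
have : 0 <= \sum_a score (Z a) X ^+ 2 by apply: sumr_ge0 => a _; exact: sqr_ge0.
by move: hV; rewrite /Z; lra.
Qed.

End superharmonic.
End generalized_bayes.

(** The derivability clause makes the gradient in the second clause a genuine one, since a
    directional derivative has a default value where the limit fails to exist. *)
Theorem theorem4p6 (R : realType) (n p : nat) (hn : (1 <= n)%N)
    (hp : (1 <= p)%N) (hnp : (0 < n - p - 1)%N)
    (pi : 'M[R]_(n, p) -> \bar R) (hpi : prior pi)
    (hsh : matrix_superharmonic pi)
    (hfin : forall X, (marginal pi X < +oo)%E) :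
  [/\ forall X a i, derivable (log_marginal pi) X (delta_mx a i),
      forall X, gen_bayes pi X = X + mx_gradient (log_marginal pi) X
    & minimax (gen_bayes pi)].
Proof.
have n0 : (0 < n)%N by exact: hn.
have [_ _ _ sh] := hsh.
have dlog X a i := is_derive_log_marginal hpi hfin (delta_mx a i) X.
split=> [X a i|X|]; first by case: (dlog X a i).
  apply/matrixP => a i; rewrite (gen_bayesE hpi hfin) !mxE.
  by have [_ ->] := dlog X a i.
have est := estimator_gen_bayes hpi hfin.
split=> // c; apply/eqP; rewrite eq_le; apply/andP; split.
  (* n |c|^2 bounds the risk of the Bayes estimator from above and the supremum risk of every
     estimator from below. *)
  apply: (@le_trans _ _ (n%:R * sqnorm c)%:E).
    apply: ge_ereal_sup => _ [M _ <-].
    exact: gen_bayes_risk_le.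
  by apply/ereal_infP => _ [T mT <-]; exact: sup_risk_ge.
by apply: ereal_inf_lbound; exists (gen_bayes pi).
Qed.
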